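(* Let $\Bbbk$ be an algebraically closed field of characteristic zero and $n\ge 2$. Let $M_1,\dots,M_k$ be a sequence of pairwise distinct skew-symmetric matrices of order $n$ over $\Bbbk$. Assume that $M_1',\dots,M_k'$ is another such sequence with $$\operatorname{rk}(M_i)=\operatorname{rk}(M_i')\quad\text{and}\quad\operatorname{Pf}(M_i)=\operatorname{Pf}(M_i')\qquad\forall i=1,\dots,k.$$ Then there exists an automorphism $g\in G_{\mathrm{skew}}$ with $g.M_i=M_i'$ for $i=1,\dots,k$.
   Context: Let $Y$ be the affine space of skew-symmetric $n\times n$ matrices over $\Bbbk$. $\operatorname{Pf}$ denotes the Pfaffian, with the convention that the Pfaffian of a matrix of odd order equals zero. The group $\mathrm{SL}_n$ acts on $Y$ via $A.B=ABA^T$. For $i\ne j$ let $E_{ij}$ be the matrix with $(i,j)$-entry $1$ and all other entries $0$, and let $H_{ij}=I_n+\Bbbk E_{ij}\subseteq\mathrm{SL}_n$, acting on $Y$ through this action as $\exp(\Bbbk\delta_{ij})$, where $\delta_{ij}$ is the corresponding locally nilpotent derivation of $\mathcal{O}(Y)$. A replica of $H_{ij}$ is a subgroup $\exp(\Bbbk f\delta_{ij})\subseteq\mathrm{Aut}(Y)$ with $f\in\ker\delta_{ij}$. $G_{\mathrm{skew}}\subseteq\mathrm{Aut}(Y)$ is the subgroup generated by all $H_{ij}$ ($i\ne j$) along with all their replicas. *)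

(* Defs.v *)
From HB Require Import structures.
From mathcomp Require Import all_boot all_order all_fingroup all_algebra.
From mathcomp Require Import mpoly.

Set Implicit Arguments.
Unset Strict Implicit.
Unset Printing Implicit Defensive.

Import GRing.Theory.
Local Open Scope ring_scope.

(* The permutation-sum formula, valid in characteristic 0.
   For even n the indices 2i and 2i+1 are i' and ordS i' with i' even, and the
   cyclic successor ordS does not wrap around at such i'. *)
Definition Pf (K : fieldType) (n : nat) (A : 'M[K]_n) : K :=
  if odd n then 0 else
  (2 ^+ n./2 * (n./2)`!%:R)^-1 *
  \sum_(s : 'S_n) (-1) ^+ s * \prod_(i < n | ~~ odd i) A (s i) (s (ordS i)).

Section SkewVariety.

Variables (K : fieldType) (n : nat).

(* Meant for characteristic different from 2, where A^T = - A forces a zero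
   diagonal. *)
Definition skew_mat := {A : 'M[K]_n | A^T == - A}.

Lemma congr_skew (A : 'M[K]_n) (B : skew_mat) :
  (A *m val B *m A^T)^T == - (A *m val B *m A^T).
Proof.
by rewrite !trmx_mul trmxK (eqP (valP B)) mulmxA mulmxN mulNmx.
Qed.

Definition congr_act (A : 'M[K]_n) (B : skew_mat) : skew_mat :=
  Sub (A *m val B *m A^T) (congr_skew A B).

Definition Hmx (i j : 'I_n) (t : K) : 'M[K]_n := 1%:M + t *: delta_mx i j.

(* O(Y) is the polynomial ring in the coordinates x_ij, i < j, of the affine
   space Y of skew-symmetric matrices. *)
Definition upper := {p : 'I_n * 'I_n | (p.1 < p.2)%N}.
Definition OY := {mpoly K[#|{: upper}|]}.

Definition evalY (F : OY) (B : skew_mat) : K :=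
  F.@[fun v => let p := val (enum_val v) in val B p.1 p.2].

Record lnd := Lnd {
  lnd_fun :> {linear OY -> OY};
  lndM : forall F G, lnd_fun (F * G) = lnd_fun F * G + F * lnd_fun G;
  lnd_nilp : forall F, exists m, iter m lnd_fun F == 0 }.

Definition lnd_exp (D : lnd) (t : K) (F : OY) : OY :=
  \sum_(m < ex_minn (lnd_nilp D F)) (t ^+ m / m`!%:R) *: iter m D F.

Section Replica.

Variables (D : lnd) (f : OY).
Hypothesis kerf : D f = 0.

Definition replica_fun (F : OY) : OY := f * D F.

Fact replica_is_linear : linear replica_fun.
Proof.
by move=> a F G; rewrite /replica_fun linearP mulrDr scalerAr.
Qed.

HB.instance Definition _ :=
  GRing.isLinear.Build K OY OY _ replica_fun replica_is_linear.

Lemma replicaM F G :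
  replica_fun (F * G) = replica_fun F * G + F * replica_fun G.
Proof. by rewrite /replica_fun lndM mulrDr mulrA (mulrCA f F). Qed.

Lemma ker_exp m : D (f ^+ m) = 0.
Proof.
elim: m => [|m IHm]; last by rewrite exprS lndM IHm kerf mul0r mulr0 addr0.
by apply: (addrI (D 1)); rewrite addr0 -[in RHS](mulr1 1) lndM mulr1 mul1r.
Qed.

Lemma iter_replica m F : iter m replica_fun F = f ^+ m * iter m D F.
Proof.
elim: m => [|m IHm] /=; first by rewrite mul1r.
by rewrite IHm /replica_fun lndM ker_exp mul0r add0r mulrA -exprS.
Qed.

Lemma replica_nilp F : exists m, iter m replica_fun F == 0.
Proof.
by case: (lnd_nilp D F) => m /eqP Dm0; exists m; rewrite iter_replica Dm0 mulr0.
Qed.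

Definition replica : lnd := @Lnd replica_fun replicaM replica_nilp.

End Replica.

Definition regular_map (g : skew_mat -> skew_mat) : Prop :=
  forall F : OY, exists F' : OY, forall B, evalY F' B = evalY F (g B).

Record autY := AutY {
  aut_fun :> skew_mat -> skew_mat;
  aut_inv : skew_mat -> skew_mat;
  aut_funK : cancel aut_fun aut_inv;
  aut_invK : cancel aut_inv aut_fun;
  aut_fun_regular : regular_map aut_fun;
  aut_inv_regular : regular_map aut_inv }.

Lemma regular_id : regular_map id.
Proof. by move=> F; exists F. Qed.

Lemma regular_comp g h :
  regular_map g -> regular_map h -> regular_map (g \o h).
Proof.
move=> rg rh F; have [F1 e1] := rg F; have [F2 e2] := rh F1.
by exists F2 => B; rewrite e2 e1.
Qed.

Definition autY1 : autY :=
  AutY (fun=> erefl) (fun=> erefl) regular_id regular_id.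

Definition autYM (g h : autY) : autY :=
  AutY (can_comp (aut_funK g) (aut_funK h))
       (can_comp (aut_invK h) (aut_invK g))
       (regular_comp (aut_fun_regular g) (aut_fun_regular h))
       (regular_comp (aut_inv_regular h) (aut_inv_regular g)).

Definition autYV (g : autY) : autY :=
  AutY (aut_invK g) (aut_funK g) (aut_inv_regular g) (aut_fun_regular g).

Definition in_H (i j : 'I_n) (g : autY) : Prop :=
  exists t, forall B, g B = congr_act (Hmx i j t) B.

(* D is the derivation delta_ij: exp(t D) is the comorphism of the action of
   I + t E_ij.  This determines D; letting matrices act on functions through
   inverses instead would replace D by - D and give the same subgroups. *)
Definition is_delta (i j : 'I_n) (D : lnd) : Prop :=
  forall t F B, evalY (lnd_exp D t F) B = evalY F (congr_act (Hmx i j t) B).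

Definition in_replica (i j : 'I_n) (g : autY) : Prop :=
  exists (D : lnd) (f : OY) (kerf : D f = 0) (t : K), is_delta i j D /\
    forall F B, evalY F (g B) = evalY (lnd_exp (replica kerf) t F) B.

Inductive Gskew : autY -> Prop :=
  | Gskew_H i j g of i != j & in_H i j g : Gskew g
  | Gskew_replica i j g of i != j & in_replica i j g : Gskew g
  | Gskew1 : Gskew autY1
  | GskewM g h of Gskew g & Gskew h : Gskew (autYM g h)
  | GskewV g of Gskew g : Gskew (autYV g).

End SkewVariety.

(* Main.v *)
From HB Require Import structures.
Require Import Defs.
From mathcomp Require Import all_boot all_order all_fingroup all_algebra.
From mathcomp Require Import mpoly ring.

Set Implicit Arguments.
Unset Strict Implicit.
Unset Printing Implicit Defensive.

Import GRing.Theory.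
Local Open Scope ring_scope.

(** Two facts carry the proof. First, the one-parameter group [H_pq] acts by
    adding [t] times row and column [q] to row and column [p], so the entries
    of row [q] lie in the kernel of the derivation [delta_pq], and so does every
    polynomial in them. Hence, when [X] differs from finitely many matrices
    [M_i] in row [q], interpolation gives a replica of [H_pq] that acts on [X]
    as a prescribed element [I + c E_pq] and fixes each [M_i]
    ([Gskew_replica_sep]). Conjugating by [P] in [SL_n] gives the same for all
    transvections [P^-1 (I + c E_pq) P], where row [q] of [X] is replaced by
    [(row q P) X] ([connects_sep]).

    Second, [rk] and [Pf] classify the orbits of [SL_n] on skew-symmetric
    matrices ([skew_elemprod_congr]): matrices of the same rank are congruent
    by some [A] in [GL_n] (split off hyperbolic planes), and [A] can be taken in
    [SL_n] either by rescaling along the radical, or, for an invertible [X],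
    because [Pf (A X A^T) = det A Pf X] and [Pf X <> 0].

    It remains to move one point [X] to another point [h X] of its
    [SL_n]-orbit with a finite set [F] fixed, where neither point is in [F]
    ([connects_elemprod]); the theorem follows by treating [M_1, ..., M_k] in
    turn. If [h] is a single transvection along a linear form [v], then [v] may
    fail to separate [X] from [F], but [h] is a product of two commuting
    transvections whose linear forms add up to [v] and are in general position,
    so that they do separate ([connects_Hmx]). If [h] is a product of transvections,
    the intermediate points [X_0 = X, X_1, ..., X_N = h X] may hit [F]; for
    [n > 2] some transvection [T] takes all of them outside [F], and the path
    [X, T X_0, T X_1, ..., T X_N, h X] consists of single transvections and
    avoids [F]. For [n = 2] the group [SL_2] acts trivially. *)

Lemma mpoly_alg_ind (K : fieldType) (m : nat) (P : {mpoly K[m]} -> Prop) :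
  (forall c, P c%:MP) -> (forall i, P 'X_i) ->
  (forall F G, P F -> P G -> P (F + G)) ->
  (forall F G, P F -> P G -> P (F * G)) -> forall F, P F.
Proof.
move=> PC PX PD PM; elim/mpolyind => [|c u F _ _ PF].
  by rewrite -mpolyC0.
apply: PD => //; rewrite -mul_mpolyC; apply: (PM) => //.
rewrite mpolyXE_id; elim/big_ind: _ => [||i _]; first by rewrite -mpolyC1.
  by move=> F1 G1; apply: PM.
elim: (u i) => [|d IHd]; first by rewrite expr0 -mpolyC1.
by rewrite exprS; apply: PM.
Qed.

(** * Coordinates on the space of skew-symmetric matrices *)

Section SkewEntries.

Variables (K : fieldType) (n : nat).
Hypothesis charK0 : [pchar K] =i pred0.
Implicit Types B : skew_mat K n.

Lemma natf_neq0_char0 m : (m.+1%:R : K) != 0.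
Proof. by have /pcharf0P -> := charK0. Qed.

Lemma skewE B i j : val B i j = - val B j i.
Proof. by have /eqP/matrixP/(_ j i) := valP B; rewrite !mxE. Qed.

Lemma skew_diag B i : val B i i = 0.
Proof.
have /eqP := skewE B i i; rewrite -addr_eq0 -mulr2n -mulr_natl mulf_eq0.
by rewrite (negPf (natf_neq0_char0 1)) => /eqP.
Qed.

(** The signed coordinate function [b_ij]; only the entries above the diagonal
    are variables of [O(Y)]. *)
Definition entryY (i j : 'I_n) : OY K n :=
  if insub (i, j) is Some u then 'X_(enum_rank (u : upper n))
  else if insub (j, i) is Some u then - 'X_(enum_rank (u : upper n)) else 0.

Definition coordY B (v : 'I_#|{: upper n}|) : K :=
  val B (val (enum_val v)).1 (val (enum_val v)).2.

Lemma evalYE (F : OY K n) B : evalY F B = F.@[coordY B].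
Proof. by []. Qed.

Lemma evalY_entry i j B : evalY (entryY i j) B = val B i j.
Proof.
rewrite evalYE /entryY; case: insubP => [u _ def_u|].
  by rewrite mevalXU /coordY enum_rankK def_u.
rewrite -leqNgt /= => le_ji; case: insubP => [u _ def_u|].
  by rewrite mevalN mevalXU /coordY enum_rankK def_u /= -skewE.
rewrite -leqNgt /= => le_ij; rewrite meval0.
have -> : i = j by apply/val_inj/eqP; rewrite eqn_leq le_ij.
by rewrite skew_diag.
Qed.

End SkewEntries.

(** * The locally nilpotent derivation of an elementary one-parameter group *)

Section ElementaryDerivation.

Variables (K : fieldType) (n : nat) (p q : 'I_n).
Hypotheses (charK0 : [pchar K] =i pred0) (neq_pq : p != q).
Implicit Types (B : skew_mat K n) (F G : OY K n).

Lemma congr_actHE t B i j :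
  val (congr_act (Hmx p q t) B) i j =
  val B i j + t * ((i == p)%:R * val B q j + (j == p)%:R * val B i q).
Proof.
have rowE m (C : 'M[K]_(n, m)) a b :
    (Hmx p q t *m C) a b = C a b + t * ((a == p)%:R * C q b).
  rewrite mulmxDl mul1mx -scalemxAl !mxE (bigD1 q) //= big1 => [|c ne_cq].
    by rewrite !mxE eqxx andbT addr0.
  by rewrite !mxE (negPf ne_cq) andbF mul0r.
have colE m (C : 'M[K]_(m, n)) a b :
    (C *m (Hmx p q t)^T) a b = C a b + t * ((b == p)%:R * C a q).
  by rewrite -[C in LHS]trmxK -trmx_mul mxE rowE !mxE.
rewrite /= colE !rowE skew_diag //.
by ring.
Qed.

(** The first order part of the action of [I + t E_pq] on the coordinates. *)
Definition entry_shift (v : 'I_#|{: upper n}|) : OY K n :=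
  let e := val (enum_val v) in
  (e.1 == p)%:R * entryY K q e.2 + (e.2 == p)%:R * entryY K e.1 q.

(** The comorphism of the action of [I + t E_pq], with [t] an indeterminate. *)
Definition flow : OY K n -> {poly OY K n} :=
  mmap (polyC \o @mpolyC _ K) (fun v => ('X_v)%:P + 'X * (entry_shift v)%:P).

Lemma flowC c : flow c%:MP = (c%:MP)%:P.
Proof. exact: mmapC. Qed.

Lemma flowX v : flow 'X_v = ('X_v)%:P + 'X * (entry_shift v)%:P.
Proof. by rewrite /flow mmapX mmap1U. Qed.

Lemma flowD F G : flow (F + G) = flow F + flow G.
Proof. exact: mmapD. Qed.

Lemma flowN F : flow (- F) = - flow F.
Proof. exact: mmapN. Qed.

Lemma flowM F G : flow (F * G) = flow F * flow G.
Proof. exact: rmorphM. Qed.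

Lemma flow_coef0 F : (flow F)`_0 = F.
Proof.
elim/mpoly_alg_ind: F => [c|v|F G IHF IHG|F G IHF IHG].
- by rewrite flowC coefC.
- by rewrite flowX coefD coefC coefXM eqxx addr0.
- by rewrite flowD coefD; congr (_ + _).
- by rewrite flowM coef0M; congr (_ * _).
Qed.

(** The derivation is read off from its flow, so that its exponential needs no
    separate computation. *)
Definition delta_fun F : OY K n := (flow F)`_1.

Fact delta_is_linear : linear delta_fun.
Proof.
move=> a F G; rewrite /delta_fun -mul_mpolyC flowD flowM flowC coefD.
by rewrite coefCM mul_mpolyC.
Qed.

HB.instance Definition _ :=
  GRing.isLinear.Build K (OY K n) (OY K n) _ delta_fun delta_is_linear.

Lemma delta_funD F G : delta_fun (F + G) = delta_fun F + delta_fun G.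
Proof. by rewrite /delta_fun flowD coefD. Qed.

Lemma delta_funM F G :
  delta_fun (F * G) = delta_fun F * G + F * delta_fun G.
Proof.
rewrite /delta_fun flowM coefM 2!big_ord_recl big_ord0 addr0 addrC.
by congr (_ * _ + _ * _); apply: flow_coef0.
Qed.

Lemma delta_funC c : delta_fun c%:MP = 0.
Proof. by rewrite /delta_fun flowC coefC. Qed.

Lemma delta_funX v : delta_fun 'X_v = entry_shift v.
Proof. by rewrite /delta_fun flowX coefD coefC coefXM coefC add0r. Qed.

(** [H_pq] only changes row and column [p], and [b_qp] only by a multiple of
    [b_qq = 0]. *)
Lemma flow_entry_row j : flow (entryY K q j) = (entryY K q j)%:P.
Proof.
have diag0 : entryY K q q = 0 by rewrite /entryY !insubF //= ltnn.
have qp : (q == p) = false by rewrite eq_sym; apply: negPf.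
rewrite {1 2}/entryY; case: insubP => [u _ def_u|_].
  rewrite flowX /entry_shift enum_rankK def_u /= qp diag0.
  by rewrite mul0r mulr0 addr0 mulr0 addr0.
case: insubP => [u _ def_u|_]; last by rewrite -mpolyC0 flowC.
rewrite flowN flowX /entry_shift enum_rankK def_u /= qp diag0.
by rewrite mul0r mulr0 addr0 mulr0 addr0 polyCN.
Qed.

Lemma delta_entry_row j : delta_fun (entryY K q j) = 0.
Proof. by rewrite /delta_fun flow_entry_row coefC. Qed.

Lemma flow_shift v : flow (entry_shift v) = (entry_shift v)%:P.
Proof.
have colE i : entryY K i q = - entryY K q i.
  rewrite /entryY; case: insubP => [u lt_iq _|le_qi].
    rewrite insubF ?opprK //=; apply/negP => /ltnW.
    by rewrite leqNgt => /negP; apply.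
  by case: insubP => *; rewrite ?oppr0.
have natC m : (m%:R : OY K n) = (m%:R)%:MP by rewrite rmorph_nat.
rewrite /entry_shift colE flowD !flowM flowN !flow_entry_row !natC !flowC.
by rewrite polyCD !polyCM polyCN.
Qed.

(** The flow equation [d/dt exp(t D) F = exp(t D) (D F)]; both sides are
    derivations along [flow], so the coordinates suffice, and there it says
    that the shifts are invariant. *)
Lemma deriv_flow F : (flow F)^`() = flow (delta_fun F).
Proof.
elim/mpoly_alg_ind: F => [c|v|F G IHF IHG|F G IHF IHG].
- by rewrite flowC derivC delta_funC -mpolyC0 flowC.
- rewrite flowX delta_funX flow_shift derivD derivC add0r derivM derivX derivC.
  by rewrite mul1r mulr0 addr0.
- rewrite delta_funD (flowD F) (flowD (delta_fun F)) derivD.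
  by congr (_ + _); [apply: IHF | apply: IHG].
- rewrite delta_funM (flowM F) derivM flowD (flowM _ G) (flowM F).
  by congr (_ * _ + _ * _); [apply: IHF | apply: IHG].
Qed.

(** The Taylor coefficients of the flow; as [flow F] is a polynomial, this gives
    local nilpotency at once. *)
Lemma iter_delta m F : iter m delta_fun F = (flow F)`_m *+ m`!.
Proof.
elim: m F => [|m IHm] F; first by rewrite flow_coef0.
by rewrite iterSr IHm -deriv_flow coef_deriv -mulrnA factS.
Qed.

Lemma delta_nilp F : exists m, iter m delta_fun F == 0.
Proof.
by exists (size (flow F)); rewrite iter_delta nth_default // mul0rn.
Qed.

Definition delta_lnd : lnd K n := Lnd delta_funM delta_nilp.

Lemma evalY_flow t F B :
  evalY (flow F).[t%:MP] B = evalY F (congr_act (Hmx p q t) B).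
Proof.
rewrite !evalYE; elim/mpoly_alg_ind: F => [c|v|F G IHF IHG|F G IHF IHG].
- by rewrite flowC hornerC !mevalC.
- rewrite flowX !hornerE mevalD mevalM !mevalXU mevalC /coordY.
  rewrite congr_actHE /entry_shift mevalD !mevalM -!mpolyC_nat !mevalC.
  by rewrite -!evalYE !evalY_entry.
- rewrite flowD hornerD 2!mevalD.
  by congr (_ + _); [apply: IHF | apply: IHG].
- rewrite flowM hornerM 2!mevalM.
  by congr (_ * _); [apply: IHF | apply: IHG].
Qed.

(** The nilpotency orders of a derivation and of its replica may differ; summing
    up to a common bound lets their exponentials be compared term by term. *)
Lemma lnd_exp_wide (D : lnd K n) t F N : iter N D F = 0 ->
  lnd_exp D t F = \sum_(m < N) (t ^+ m / m`!%:R) *: iter m D F.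
Proof.
move=> DN0; rewrite /lnd_exp; case: ex_minnP => k /eqP Dk0 min_k.
have le_kN : (k <= N)%N by apply: min_k; rewrite DN0.
rewrite (big_ord_widen _ (fun m => (t ^+ m / m`!%:R) *: iter m D F) le_kN).
rewrite [RHS](bigID (fun m : 'I_N => (m < k)%N)) /= [X in _ + X]big1 ?addr0 // => m.
have iterD0 j : iter j D 0 = 0 by elim: j => //= j ->; apply: linear0.
by rewrite -leqNgt => /subnK <-; rewrite iterD Dk0 iterD0 scaler0.
Qed.

Lemma is_delta_lnd : is_delta p q delta_lnd.
Proof.
move=> t F B; rewrite -evalY_flow; congr evalY.
rewrite (@lnd_exp_wide _ _ _ (size (flow F))); last first.
  by rewrite iter_delta nth_default // mul0rn.
rewrite horner_coef; apply: eq_bigr => m _.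
have fact_neq0 : (m`!%:R : K) != 0.
  by have := fact_gt0 m; case: (m`!) => // k _; apply: natf_neq0_char0.
rewrite iter_delta -scaler_nat scalerA divfK // -mul_mpolyC.
by rewrite rmorphXn mulrC.
Qed.

(** Along an orbit of [H_pq] a function [f] in the kernel is constant, so the
    replica with [f] moves [B] as [I + f(B) E_pq] does. *)
Lemma evalY_replica f (kerf : delta_lnd f = 0) t F B :
  evalY (lnd_exp (replica kerf) t F) B =
  evalY F (congr_act (Hmx p q (t * evalY f B)) B).
Proof.
rewrite -is_delta_lnd; have [N /eqP DN0] := lnd_nilp delta_lnd F.
rewrite (lnd_exp_wide _ DN0) (@lnd_exp_wide _ _ _ N); last first.
  exact: etrans (iter_replica kerf N F) (etrans (congr1 _ DN0) (mulr0 _)).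
rewrite !evalYE !raddf_sum; apply: eq_bigr => m _ /=.
rewrite !mevalZ; have -> := iter_replica kerf m F.
by rewrite mevalM rmorphXn /= exprMn; ring.
Qed.

Lemma congr_actH_ker f t B : delta_lnd f = 0 ->
  evalY f (congr_act (Hmx p q t) B) = evalY f B.
Proof.
move=> kerf; rewrite -is_delta_lnd (@lnd_exp_wide _ _ _ 1) //.
by rewrite big_ord1 expr0 divr1 scale1r.
Qed.

Lemma HmxD t s : Hmx p q (t + s) = Hmx p q t *m Hmx p q s :> 'M[K]_n.
Proof.
rewrite /Hmx mulmxDl !mulmxDr !mul1mx mulmx1 -scalemxAl -scalemxAr.
rewrite mul_delta_mx_cond eq_sym (negPf neq_pq) mulr0n !scaler0 addr0.
by rewrite scalerDl addrA addrAC.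
Qed.

End ElementaryDerivation.

(** * Replicas that separate points *)

Section CongruenceAction.

Variables (K : fieldType) (n : nat).
Implicit Types (A : 'M[K]_n) (B : skew_mat K n).

Lemma congr_act1 B : congr_act 1%:M B = B.
Proof. by apply/val_inj; rewrite /= trmx1 mul1mx mulmx1. Qed.

Lemma congr_actM A1 A2 B : congr_act (A1 *m A2) B = congr_act A1 (congr_act A2 B).
Proof. by apply/val_inj; rewrite /= trmx_mul !mulmxA. Qed.

Lemma Hmx0 (p q : 'I_n) : Hmx p q 0 = 1%:M :> 'M[K]_n.
Proof. by rewrite /Hmx scale0r addr0. Qed.

End CongruenceAction.

Section Replicas.

Variables (K : fieldType) (n : nat) (p q : 'I_n).
Hypotheses (charK0 : [pchar K] =i pred0) (neq_pq : p != q).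
Implicit Types (B X : skew_mat K n) (F : seq (skew_mat K n)).

Notation D := (delta_lnd K neq_pq).

Lemma Gskew_replica_act f : D f = 0 -> exists g : autY K n,
  Gskew g /\ forall B, g B = congr_act (Hmx p q (evalY f B)) B.
Proof.
move=> kerf.
have canH s : cancel (fun B => congr_act (Hmx p q (s * evalY f B)) B)
                     (fun B => congr_act (Hmx p q (- s * evalY f B)) B).
  move=> B; rewrite congr_actH_ker // -congr_actM -HmxD // mulNr addNr.
  by rewrite Hmx0 congr_act1.
have regH s : regular_map (fun B => congr_act (Hmx p q (s * evalY f B)) B).
  by move=> F; exists (lnd_exp (replica kerf) s F) => B; apply: evalY_replica.
have canHV := canH (-1); rewrite opprK in canHV.
exists (AutY (canH 1) canHV (regH 1) (regH (-1))); split; last first.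
  by move=> B /=; rewrite mul1r.
apply: (@Gskew_replica _ _ p q) => //.
exists D, f, kerf, 1; split; first exact: is_delta_lnd.
by move=> F B; rewrite evalY_replica.
Qed.

Lemma Gskew_Hmx t : exists g : autY K n,
  Gskew g /\ forall B, g B = congr_act (Hmx p q t) B.
Proof.
have [g [Gg gE]] := Gskew_replica_act (delta_funC p q t).
by exists g; split=> // B; rewrite gE evalYE mevalC.
Qed.

(** The entries of row [q] generate an algebra in the kernel of [delta_pq], in
    which some [f] takes the value [c] at [X] and vanishes on [F]. *)
Lemma Gskew_replica_sep F X c :
  (forall M, M \in F -> exists k, val M q k != val X q k) ->
  exists g : autY K n, [/\ Gskew g,
    forall B, exists t, g B = congr_act (Hmx p q t) B,
    g X = congr_act (Hmx p q c) X & forall M, M \in F -> g M = M].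
Proof.
move=> sepF.
have [f [kerf fX fF]] : exists f, [/\ D f = 0, evalY f X = c
    & forall M, M \in F -> evalY f M = 0].
  elim: F sepF => [|M F IHF] sepF.
    by exists c%:MP; split=> //; [apply: delta_funC | rewrite evalYE mevalC].
  have [|f [kerf fX fF]] := IHF.
    by move=> N FN; apply: sepF; rewrite inE FN orbT.
  have [|k neqMX] := sepF M; first by rewrite inE eqxx.
  exists (((val X q k - val M q k)^-1)%:MP
          * (f * (entryY K q k - (val M q k)%:MP))).
  have evE B : evalY (((val X q k - val M q k)^-1)%:MP
      * (f * (entryY K q k - (val M q k)%:MP))) B =
      (val X q k - val M q k)^-1 * (evalY f B * (val B q k - val M q k)).
    by rewrite evalYE !mevalM mevalB !mevalC -!evalYE evalY_entry.
  split.
  - rewrite !lndM.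
    have -> : D (entryY K q k - (val M q k)%:MP) = 0.
      apply: etrans (raddfB D _ _) _.
      have e := congr2 (fun a b : OY K n => a - b)
        (delta_entry_row K neq_pq k) (delta_funC p q (val M q k)).
      exact: etrans e (subrr 0).
    have -> : D ((val X q k - val M q k)^-1)%:MP = 0 by apply: delta_funC.
    by rewrite kerf !mul0r !mulr0 addr0 mulr0 addr0.
  - by rewrite evE fX mulrC mulfK // subr_eq0 eq_sym.
  - move=> N; rewrite inE => /orP[/eqP ->|FN].
      by rewrite evE subrr !mulr0.
    by rewrite evE fF // mul0r mulr0.
have [g [Gg gE]] := Gskew_replica_act kerf.
exists g; split=> // [B||M FM]; [by exists (evalY f B) | by rewrite gE fX |].
by rewrite gE fF // Hmx0 congr_act1.
Qed.

End Replicas.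

(** * Products of elementary matrices *)

Section ElementaryMatrices.

Variable K : fieldType.

Inductive elemprod (n : nat) : 'M[K]_n -> Prop :=
| Elemprod1 : elemprod 1%:M
| ElemprodS p q t A of p != q & elemprod A : elemprod (Hmx p q t *m A).

Lemma elemprodH n (p q : 'I_n) t : p != q -> elemprod (Hmx p q t).
Proof. by move=> pq; rewrite -[Hmx _ _ _]mulmx1; do 2?constructor. Qed.

Lemma elemprodM n (A B : 'M[K]_n) :
  elemprod A -> elemprod B -> elemprod (A *m B).
Proof.
move=> eA eB; elim: eA => [|p q t C pq _ IH]; first by rewrite mul1mx.
by rewrite -mulmxA; constructor.
Qed.

Lemma Hmx_tr n (p q : 'I_n) t : (Hmx p q t)^T = Hmx q p t :> 'M[K]_n.
Proof. by rewrite /Hmx linearD /= trmx1 linearZ /= trmx_delta. Qed.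

Lemma elemprodT n (A : 'M[K]_n) : elemprod A -> elemprod A^T.
Proof.
elim=> [|p q t B pq _ IH]; first by rewrite trmx1; constructor.
by rewrite trmx_mul Hmx_tr; apply: elemprodM => //; apply: elemprodH; rewrite eq_sym.
Qed.

Lemma HmxVK n (p q : 'I_n) t :
  p != q -> Hmx p q (- t) *m Hmx p q t = 1%:M :> 'M[K]_n.
Proof. by move=> pq; rewrite -HmxD // addNr Hmx0. Qed.

Lemma elemprodV n (A : 'M[K]_n) : elemprod A ->
  exists2 B, elemprod B & B *m A = 1%:M.
Proof.
elim=> [|p q t C pq _ [B eB BC]].
  by exists 1%:M; [constructor | rewrite mulmx1].
exists (B *m Hmx p q (- t)); first by apply: elemprodM => //; apply: elemprodH.
by rewrite mulmxA -(mulmxA B) HmxVK // mulmx1.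
Qed.

(** Adding to row [q] a combination of the other rows is done one row after the
    other: the cross terms vanish because [w_q = 0]. *)
Lemma elemprod_row n (q : 'I_n) (w : 'rV[K]_n) :
  w 0 q = 0 -> elemprod (1%:M + delta_mx q 0 *m w).
Proof.
move=> wq; rewrite [w]row_sum_delta.
pose P (u : 'rV[K]_n) := u 0 q = 0 /\ elemprod (1%:M + delta_mx q 0 *m u).
suff [] : P (\sum_j w 0 j *: delta_mx 0 j) by [].
apply: (big_ind P) => [|u v [uq eu] [vq ev]|j _].
- by split; [rewrite mxE | rewrite mulmx0 addr0; constructor].
- split; first by rewrite mxE uq vq addr0.
  have <- : (1%:M + delta_mx q 0 *m u) *m (1%:M + delta_mx q 0 *m v) =
      1%:M + delta_mx q 0 *m (u + v).
    have uq0 : u *m (delta_mx q 0 : 'cV_n) = 0.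
      apply/matrixP=> a b; rewrite !ord1 !mxE (bigD1 q) //= uq mul0r add0r.
      by rewrite big1 // => c cq; rewrite mxE (negPf cq) mulr0.
    rewrite mulmxDl mul1mx mulmxDr mulmx1 -(mulmxA _ u) (mulmxA u) uq0.
    by rewrite mul0mx mulmx0 addr0 mulmxDr -addrA [X in _ + X]addrC.
  exact: elemprodM.
- have [->|neq_jq] := eqVneq j q.
    by rewrite wq scale0r; split; [rewrite mxE | rewrite mulmx0 addr0; constructor].
  split; first by rewrite !mxE eq_sym (negPf neq_jq) andbF mulr0.
  by rewrite -scalemxAr mul_delta_mx; apply: elemprodH; rewrite eq_sym.
Qed.

Lemma det_Hmx n (p q : 'I_n) t : \det (Hmx p q t) = 1 + t * (p == q)%:R :> K.
Proof.
wlog le_qp : p q / (q <= p)%N.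
  move=> IH; have [/IH //|/ltnW/IH] := leqP q p.
  by rewrite -det_tr Hmx_tr eq_sym.
rewrite det_trig; last first.
  apply/is_trig_mxP => i j lt_ij; rewrite !mxE.
  have /negPf -> : i != j by rewrite neq_ltn lt_ij.
  case: eqP => [ip|]; last by rewrite mulr0 addr0.
  case: eqP => [jq|]; last by rewrite mulr0 addr0.
  by move: lt_ij; rewrite ip jq ltnNge le_qp.
rewrite (bigD1 p) //= !mxE !eqxx /= big1 ?mulr1 // => i ne_ip.
by rewrite !mxE eqxx (negPf ne_ip) mulr0 addr0.
Qed.

Lemma det_elemprod n (A : 'M[K]_n) : elemprod A -> \det A = 1.
Proof.
elim=> [|p q t B pq _ IH]; first exact: det1.
by rewrite det_mulmx det_Hmx (negPf pq) mulr0 addr0 mul1r.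
Qed.

Lemma elemprod_unitmx n (A : 'M[K]_n) : elemprod A -> A \in unitmx.
Proof. by move/det_elemprod=> dA; rewrite unitmxE dA unitr1. Qed.

Lemma elemprod_ublock n (b : 'rV[K]_n) :
  elemprod (block_mx 1%:M b 0 1%:M : 'M_(1 + n)).
Proof.
have -> : (block_mx 1%:M b 0 1%:M : 'M_(1 + n)) =
    1%:M + delta_mx (lshift n 0) 0 *m row_mx 0 b.
  rewrite -[delta_mx _ _]vsubmxK mul_col_row.
  have -> : usubmx (delta_mx (lshift n 0) 0 : 'M[K]_(1 + n, 1)) = 1%:M.
    by apply/matrixP=> i j; rewrite !ord1 !mxE !eqxx.
  have -> : dsubmx (delta_mx (lshift n 0) 0 : 'M[K]_(1 + n, 1)) = 0.
    by apply/matrixP=> i j; rewrite !mxE.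
  rewrite !mulmx0 mul1mx mul0mx [X in X + _]scalar_mx_block add_block_mx.
  by rewrite !addr0 add0r.
by apply: elemprod_row; rewrite (row_mxEl 0 b) mxE.
Qed.

Lemma elemprod_lblock n (c : 'cV[K]_n) :
  elemprod (block_mx 1%:M 0 c 1%:M : 'M_(1 + n)).
Proof.
have := elemprodT (elemprod_ublock c^T).
by rewrite tr_block_mx !trmx1 trmx0 trmxK.
Qed.

Lemma Hmx_block n (p q : 'I_n) t :
  block_mx 1%:M 0 0 (Hmx p q t) =
  Hmx (rshift 1 p) (rshift 1 q) t :> 'M[K]_(1 + n).
Proof.
rewrite /Hmx [X in _ = X + _]scalar_mx_block.
have -> : delta_mx (rshift 1 p) (rshift 1 q) =
    block_mx 0 0 0 (delta_mx p q) :> 'M[K]_(1 + n).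
  apply/matrixP=> i j; rewrite !mxE.
  case: splitP => a ia; rewrite !mxE; case: splitP => b jb; rewrite !mxE;
  rewrite -!val_eqE /= ia jb //= ?ord1 ?eqn_add2l //=.
  by rewrite andbF.
by rewrite scale_block_mx !scaler0 add_block_mx !addr0.
Qed.

Lemma elemprod_block n (A : 'M[K]_n) :
  elemprod A -> elemprod (block_mx 1%:M 0 0 A : 'M_(1 + n)).
Proof.
elim=> [|p q t B pq _ IH]; first by rewrite -scalar_mx_block; constructor.
have -> : (block_mx 1%:M 0 0 (Hmx p q t *m B) : 'M_(1 + n)) =
    block_mx 1%:M 0 0 (Hmx p q t) *m block_mx 1%:M 0 0 B.
  by rewrite mulmx_block !mulmx0 !mul0mx !mulmx1 !addr0 add0r.
by rewrite Hmx_block; constructor.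
Qed.

(** Gaussian elimination by adding multiples of rows to other rows: with no
    scaling allowed, the determinant is pushed into the last diagonal entry. *)
Lemma unitmx_elemprod n (A : 'M[K]_n.+1) : A \in unitmx ->
  exists2 E, elemprod E & A = E *m Hmx ord_max ord_max (\det A - 1).
Proof.
elim: n A => [|n IHn] A uA.
  exists 1%:M; first by constructor.
  rewrite mul1mx [A]mx11_scalar det_scalar expr1.
  apply/matrixP=> i j; rewrite !ord1 !mxE !eqxx /=; ring.
suff [E eE [E' eE' defA]] : exists2 E, elemprod E & exists2 E', elemprod E' &
    exists d, E *m A = E' *m Hmx ord_max ord_max (d - 1).
  have [F eF FE] := elemprodV eE; case: defA => d defA.
  have defA' : A = F *m E' *m Hmx ord_max ord_max (d - 1).
    by rewrite -mulmxA -defA mulmxA FE mul1mx.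
  exists (F *m E'); first exact: elemprodM.
  suff -> : \det A = d by [].
  rewrite defA' det_mulmx det_Hmx eqxx mulr1.
  by rewrite (det_elemprod (elemprodM eF eE')) mul1r addrCA subrr addr0.
have [i0 Ai0] : exists i, A i 0 != 0.
  apply/existsP; apply: contraLR uA; rewrite negb_exists => /forallP A0.
  rewrite unitmxE -det_tr (expand_det_row _ 0) big1 ?unitr0 // => j _.
  by have := A0 j; rewrite negbK mxE => /eqP ->; rewrite mul0r.
have HE p q t j : (Hmx p q t *m A) p j = A p j + t * A q j.
  rewrite mulmxDl mul1mx -scalemxAl !mxE (bigD1 q) //= big1 => [|c ne_cq].
    by rewrite !mxE !eqxx mul1r addr0.
  by rewrite !mxE (negPf ne_cq) andbF mul0r.
have pivot (B : 'M[K]_n.+2) i : i != 0 -> B i 0 != 0 ->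
    exists2 E, elemprod E & (E *m B) 0 0 = 1.
  move=> i_neq0 Bi; exists (Hmx 0 i ((1 - B 0 0) / B i 0)).
    by apply: elemprodH; rewrite eq_sym.
  rewrite mulmxDl mul1mx -scalemxAl !mxE (bigD1 i) //= big1 => [|c ne_ci].
    by rewrite !mxE !eqxx mul1r addr0 divfK // addrC subrK.
  by rewrite !mxE (negPf ne_ci) andbF mul0r.
(* If the corner is the only nonzero entry of its column, copy it to the last
   row, from where it serves as a pivot. *)
have [E1 eE1 pivE1] : exists2 E, elemprod E & (E *m A) 0 0 = 1.
  have [i00|i_neq0] := eqVneq i0 0; last exact: pivot Ai0.
  have A0 := Ai0; rewrite i00 in A0.
  have [Al0|Al0] := eqVneq (A ord_max 0) 0; last by apply: pivot Al0.
  have [|E2 eE2 piv2] := pivot (Hmx ord_max 0 1 *m A) ord_max isT.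
    by rewrite HE Al0 add0r mul1r.
  exists (E2 *m Hmx ord_max 0 1); last by rewrite -mulmxA.
  by apply: elemprodM => //; apply: elemprodH.
exists E1 => //.
have: E1 *m A \in unitmx by rewrite unitmx_mul elemprod_unitmx.
move: (E1 *m A) pivE1 => /= {A uA i0 Ai0 HE pivot E1 eE1} A A00 uA.
rewrite -[A](@submxK _ 1 n.+1 1 n.+1) in uA *.
have ulA : ulsubmx (A : 'M_(1 + n.+1)) = 1%:M.
  apply/matrixP=> i j; rewrite !ord1 !mxE eqxx -A00.
  by congr (A _ _); apply/val_inj.
move: (ursubmx _) (dlsubmx _) (drsubmx _) uA => b c S0; rewrite ulA => uA.
(* The Schur complement of the corner. *)
pose S := S0 - c *m b.
have defA : block_mx 1%:M b c S0 =
    block_mx 1%:M 0 c 1%:M *m block_mx 1%:M b 0 S :> 'M_(1 + n.+1).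
  by rewrite mulmx_block !mulmx0 !mul0mx !mulmx1 !mul1mx !addr0 addrC subrK.
have uS : S \in unitmx.
  move: uA; rewrite defA unitmx_mul => /andP[_ uU].
  have dU : \det (block_mx 1%:M b 0 S : 'M_(1 + n.+1)) = \det S.
    by rewrite det_ublock det1 mul1r.
  by rewrite unitmxE -dU -unitmxE; apply: uU.
have [E eE defS] := IHn _ uS; move: (\det S - 1) (\det S) defS => _ d defS.
exists (block_mx 1%:M 0 c 1%:M *m block_mx 1%:M (b *m invmx S) 0 1%:M
        *m block_mx 1%:M 0 0 E).
  apply: elemprodM; last exact: elemprod_block.
  by apply: elemprodM; [apply: elemprod_lblock | apply: elemprod_ublock].
have eqU : block_mx 1%:M b 0 S = block_mx 1%:M (b *m invmx S) 0 1%:M *m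
    (block_mx 1%:M 0 0 E *m block_mx 1%:M 0 0 (Hmx ord_max ord_max (d - 1)))
    :> 'M_(1 + n.+1).
  rewrite !mulmx_block !mulmx0 !mul0mx !mulmx1 !mul1mx !addr0 !add0r -defS.
  by rewrite mulmxKV // mulmx0 addr0.
exists d; have -> : Hmx ord_max ord_max (d - 1) =
    Hmx (rshift 1 ord_max) (rshift 1 ord_max) (d - 1) :> 'M[K]_(1 + n.+1).
  by congr Hmx; apply/val_inj.
by rewrite defA eqU -Hmx_block !mulmxA.
Qed.

End ElementaryMatrices.

(** * The Pfaffian *)

Section Pfaffian.

Variables (K : fieldType) (n : nat).
Hypothesis charK0 : [pchar K] =i pred0.

Section EvenOrder.

Variable X : 'M[K]_n.
Hypothesis n_even : ~~ odd n.
Implicit Type phi : 'I_n -> 'rV[K]_n.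

Lemma odd_ordS (i : 'I_n) : odd (ordS i) = ~~ odd i.
Proof.
rewrite /=; have := ltn_ord i; rewrite leq_eqVlt => /orP[/eqP i_max|lt_in].
  by rewrite i_max modnn -[odd i]negbK -oddS i_max (negPf n_even).
by rewrite modn_small.
Qed.

Lemma ordS_neq (i : 'I_n) : ordS i != i.
Proof. by apply/eqP=> e; have := odd_ordS i; rewrite e; case: odd. Qed.

Let bil (u v : 'rV[K]_n) : K := (u *m X *m v^T) 0 0.

Let bilDl a u1 b u2 v : bil (a *: u1 + b *: u2) v = a * bil u1 v + b * bil u2 v.
Proof. by rewrite /bil !mulmxDl -!scalemxAl !mxE. Qed.

Let bilDr a u1 b u2 v : bil v (a *: u1 + b *: u2) = a * bil v u1 + b * bil v u2.
Proof. by rewrite /bil linearD !linearZ /= mulmxDr -!scalemxAr !mxE. Qed.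

(** The Pfaffian of [(phi_i X phi_j^T)_ij], up to the constant factor, seen as
    a function of the rows [phi_i]. *)
Definition pfsum phi : K :=
  \sum_(s : 'S_n) (-1) ^+ s *
    \prod_(i < n | ~~ odd i) bil (phi (s i)) (phi (s (ordS i))).

(** Each index occurs in exactly one factor, because the even indices and their
    successors exhaust all indices when [n] is even. *)
Lemma pfterm_linear j a b phi phi1 phi2 :
  (forall i, i != j -> phi1 i = phi i /\ phi2 i = phi i) ->
  phi j = a *: phi1 j + b *: phi2 j ->
  \prod_(i < n | ~~ odd i) bil (phi i) (phi (ordS i)) =
  a * (\prod_(i < n | ~~ odd i) bil (phi1 i) (phi1 (ordS i))) +
  b * (\prod_(i < n | ~~ odd i) bil (phi2 i) (phi2 (ordS i))).
Proof.
move=> off_j phi_j.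
have [i0 [i0_even i0E]] : exists i0 : 'I_n, ~~ odd i0 /\ (i0 = j \/ ordS i0 = j).
  have [j_odd|j_even] := boolP (odd j); last by exists j; split; [|left].
  by exists (ord_pred j); rewrite ord_predK -odd_ordS ord_predK j_odd; split; [|right].
have off_i0 (i : 'I_n) : ~~ odd i -> i != i0 -> i != j /\ ordS i != j.
  move=> i_even ne_i; case: i0E => [i0j|Si0j]; split.
  - by rewrite -i0j.
  - by apply: contraNneq i0_even => e; rewrite i0j -e odd_ordS.
  - by apply: contraNneq i_even => ->; rewrite -Si0j (odd_ordS i0).
  - by rewrite -Si0j (can_eq (@ordSK n)).
rewrite !(bigD1 i0 i0_even) /=.
have eq1 phi' : (forall i, i != j -> phi' i = phi i) ->
    \prod_(i < n | ~~ odd i && (i != i0)) bil (phi' i) (phi' (ordS i)) =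
    \prod_(i < n | ~~ odd i && (i != i0)) bil (phi i) (phi (ordS i)).
  by move=> e; apply: eq_bigr => i /andP[/off_i0 o /o[nij nSij]]; rewrite !e.
rewrite (eq1 phi1) ?(eq1 phi2); try by move=> i /off_j[].
set R := \prod_(i < n | _) _; rewrite !mulrA -mulrDl; congr (_ * R).
case: i0E => [i0j|Si0j].
  have [e1 e2] := off_j _ (ordS_neq j).
  by rewrite i0j phi_j bilDl e1 e2.
have nj : i0 != j by rewrite -Si0j eq_sym ordS_neq.
have [e1 e2] := off_j _ nj.
by rewrite Si0j phi_j bilDr e1 e2.
Qed.

(** With [pfsum_alternate] this makes [pfsum] a multiple of the determinant. *)
Lemma pfsum_linear p a b phi phi1 phi2 :
  (forall i, i != p -> phi1 i = phi i /\ phi2 i = phi i) ->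
  phi p = a *: phi1 p + b *: phi2 p ->
  pfsum phi = a * pfsum phi1 + b * pfsum phi2.
Proof.
move=> off_p phi_p; rewrite /pfsum !mulr_sumr -big_split; apply: eq_bigr => s _ /=.
rewrite (@pfterm_linear ((s^-1)%g p) a b (phi \o s) (phi1 \o s) (phi2 \o s)) /=.
- by rewrite mulrDr mulrCA [X in _ + X]mulrCA.
- by move=> i ne_ip; apply: off_p; rewrite -(inj_eq (@perm_inj _ s^-1%g)) permK.
- by rewrite permKV.
Qed.

Lemma pfsum_alternate p q phi : p != q -> phi p = phi q -> pfsum phi = 0.
Proof.
move=> neq_pq eq_pq.
have: pfsum phi = - pfsum phi.
  rewrite {1}/pfsum (reindex_inj (mulIg (tperm p q))) -sumrN /=.
  apply: eq_bigr => s _; rewrite odd_permM odd_tperm neq_pq signr_addb expr1.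
  rewrite mulrN1 mulNr; congr (- (_ * _)); apply: eq_bigr => i _.
  have phi_t j : phi (tperm p q j) = phi j by case: tpermP => // ->.
  by rewrite !permM !phi_t.
move/eqP; rewrite -addr_eq0 -mulr2n -mulr_natl mulf_eq0.
by rewrite (negPf (natf_neq0_char0 charK0 1)) => /eqP.
Qed.

Lemma Pf_congr (A : 'M[K]_n) : Pf (A *m X *m A^T) =
  (2 ^+ n./2 * (n./2)`!%:R)^-1 * pfsum (fun i => row i A).
Proof.
rewrite /Pf (negPf n_even); congr (_ * _); apply: eq_bigr => s _.
congr (_ * _); apply: eq_bigr => i _.
rewrite /bil -row_mul mxE [RHS]mxE; apply: eq_bigr => k _.
by rewrite !mxE.
Qed.

End EvenOrder.

Lemma Pf_Hmx (X : 'M[K]_n) p q t :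
  Pf (Hmx p q t *m X *m (Hmx p q t)^T) = (1 + t * (p == q)%:R) * Pf X.
Proof.
have [n_odd|n_even] := boolP (odd n); first by rewrite /Pf n_odd mulr0.
have := Pf_congr X n_even 1%:M; rewrite mul1mx trmx1 mulmx1 => ->.
rewrite Pf_congr // mulrCA; congr (_ * _).
pose phi2 i : 'rV[K]_n := row (if i == p then q else i) 1%:M.
rewrite (@pfsum_linear _ n_even p 1 t _ (fun i => row i 1%:M) phi2).
- rewrite mul1r mulrDl mul1r -mulrA; congr (_ + t * _).
  have [eq_pq|neq_pq] := eqVneq p q.
    rewrite mul1r; apply: eq_bigr => s _; congr (_ * _); apply: eq_bigr => i _.
    have phi2E j : phi2 j = row j 1%:M by rewrite /phi2; case: eqP => // ->; rewrite -eq_pq.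
    by rewrite !phi2E.
  rewrite mul0r (@pfsum_alternate X p q) // /phi2 eqxx.
  by rewrite eq_sym (negPf neq_pq).
- move=> i neq_ip; rewrite /phi2 (negPf neq_ip); split=> //;
  by apply/rowP=> j; rewrite !mxE (negPf neq_ip) mulr0 addr0.
- by apply/rowP=> j; rewrite /phi2 eqxx !mxE eqxx mul1r (eq_sym q).
Qed.

Lemma Pf_elemprod (X A : 'M[K]_n) : elemprod A -> Pf (A *m X *m A^T) = Pf X.
Proof.
elim=> [|p q t B neq_pq _ IH]; first by rewrite trmx1 mul1mx mulmx1.
rewrite trmx_mul !mulmxA -(mulmxA _ B) -(mulmxA _ (B *m X)) Pf_Hmx.
by rewrite (negPf neq_pq) mulr0 addr0 mul1r.
Qed.

Definition mate (i : 'I_n) : 'I_n := if odd i then ord_pred i else ordS i.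

(** The standard symplectic form; the indices [2i], [2i + 1] belong to dual
    basis vectors. *)
Definition sympl_mx : 'M[K]_n :=
  \matrix_(i, j) (if j == mate i then (-1) ^+ odd i else 0).

Section SymplecticForm.

Hypothesis n_even : ~~ odd n.

Lemma odd_mate i : odd (mate i) = ~~ odd i.
Proof.
rewrite /mate; case: ifP => i_odd; last by rewrite odd_ordS // i_odd.
by have := odd_ordS n_even (ord_pred i); rewrite ord_predK i_odd; case: odd.
Qed.

Lemma mateK : involutive mate.
Proof.
move=> i; rewrite {1}/mate odd_mate /mate.
by case: (odd i); rewrite /= ?ord_predK ?ordSK.
Qed.

Definition mate_perm : 'S_n := perm (inv_inj mateK).

(** A permutation that preserves both the pairs and the parity permutes the odd
    indices as it permutes the even ones. *)
Lemma even_perm_mate (s : 'S_n) :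
  (forall i, s (mate i) = mate (s i)) -> (forall i, odd (s i) = odd i) ->
  odd_perm s = false.
Proof.
move=> s_mate s_odd.
have inj_e : injective (fun i : 'I_n => if odd i then i else s i).
  move=> i j; case: ifP => oi; case: ifP => oj //; last exact: perm_inj.
    by move=> e; move: oi; rewrite e s_odd oj.
  by move=> e; move: oj; rewrite -e s_odd oi.
pose e := perm inj_e.
have -> : s = (e * e ^ mate_perm)%g.
  apply/permP=> i; rewrite permM conjgE !permM.
  have mV j : ((mate_perm^-1)%g j) = mate j.
    by apply: (@perm_inj _ mate_perm); rewrite permKV permE mateK.
  rewrite mV !permE; case oi: (odd i); rewrite odd_mate ?s_odd oi /=.
    by rewrite -s_mate mateK.
  by rewrite mateK.
by rewrite odd_permM odd_permJ addbb.
Qed.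

(** Exchanging the images of a pair changes both signs. *)
Lemma sign_perm_mate (s : 'S_n) : (forall i, s (mate i) = mate (s i)) ->
  (-1) ^+ s * \prod_(i < n | ~~ odd i) (-1) ^+ odd (s i) = 1 :> K.
Proof.
have [m] := ubnP #|[pred i : 'I_n | ~~ odd i && odd (s i)]|.
elim: m s => // m IHm s; rewrite ltnS => card_s s_mate.
have [i /andP[i_even si_odd]|no_i] := pickP [pred i : 'I_n | ~~ odd i && odd (s i)]; last first.
  have s_odd i : odd (s i) = odd i.
    have := no_i i; have := no_i (mate i); rewrite /= s_mate !odd_mate.
    by case: (odd i); case: (odd (s i)).
  rewrite even_perm_mate // mul1r big1 // => i i_even.
  by rewrite s_odd (negPf i_even).
have neq_i : i != mate i.
  by apply/eqP=> e; have := odd_mate i; rewrite -e; case: odd.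
pose s' := (tperm i (mate i) * s)%g.
have s'E j : s' j = if j == i then mate (s i) else if j == mate i then s i else s j.
  rewrite permM; case: tpermP => [->|->|/eqP/negPf -> /eqP/negPf ->] //.
    by rewrite eqxx s_mate.
  by rewrite eq_sym (negPf neq_i) eqxx.
have s'_mate j : s' (mate j) = mate (s' j).
  rewrite !s'E (inj_eq (inv_inj mateK)) -(inj_eq (inv_inj mateK) (mate j)) mateK.
  have [->|ne_ji] := eqVneq j i; first by rewrite (negPf neq_i) mateK.
  by case: eqP.
have mi_odd : odd (mate i) by rewrite odd_mate.
have s's (j : 'I_n) : ~~ odd j -> j != i -> s' j = s j.
  move=> j_even ne_ji; rewrite s'E (negPf ne_ji); case: eqP => // jm.
  by rewrite jm mi_odd in j_even.
rewrite -[RHS](IHm s') //; last first.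
  apply: leq_trans card_s; apply: proper_card; apply/properP; split.
    apply/subsetP=> j; rewrite !inE => /andP[j_even].
    rewrite j_even; have [->|ne_ji] := eqVneq j i; first by rewrite si_odd.
    by rewrite s's.
  exists i; rewrite !inE ?i_even ?si_odd //.
  by rewrite s'E eqxx odd_mate si_odd.
rewrite odd_permM odd_tperm neq_i signr_addb expr1.
rewrite (bigD1 i) //= [in RHS](bigD1 i) //=.
rewrite s'E eqxx odd_mate si_odd expr0 mul1r expr1 !mulN1r mulrN mulNr.
congr (- (_ * _)); apply: eq_bigr => j /andP[j_even ne_ji].
by rewrite s's.
Qed.

(** All nonzero terms of the permutation sum are [1], so the sum is a positive
    integer. *)
Lemma Pf_sympl_neq0 : Pf sympl_mx != 0.
Proof.
have natK m : (0 < m)%N -> m%:R != 0 :> K.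
  by case: m => // m _; apply: natf_neq0_char0.
rewrite /Pf (negPf n_even) mulf_neq0 ?invr_eq0 ?mulf_neq0 ?expf_neq0 //.
- exact: natK.
- exact/natK/fact_gt0.
pose good (s : 'S_n) := [forall i : 'I_n, s (mate i) == mate (s i)].
rewrite (eq_bigr (fun s : 'S_n => (good s)%:R)) => [|s _].
  rewrite -natr_sum natK // (bigD1 1%g) //=.
  by have -> : good 1%g by apply/forallP=> i; rewrite !perm1.
have [/forallP s_mate|] := boolP (good s).
  rewrite -[RHS](@sign_perm_mate s) => [|i]; last exact/eqP.
  congr (_ * _); apply: eq_bigr => i i_even; rewrite mxE ifT //.
  by rewrite -(eqP (s_mate i)) /mate (negPf i_even).
rewrite negb_forall => /existsP[i bad_i].
have [j j_even bad_j] : exists2 j : 'I_n, ~~ odd j & s (mate j) != mate (s j).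
  have [i_odd|i_even] := boolP (odd i); last by exists i.
  exists (mate i); first by rewrite odd_mate i_odd.
  by rewrite mateK -(inj_eq (inv_inj mateK)) mateK eq_sym.
rewrite (bigD1 j) //= mxE ifF ?mul0r ?mulr0 //.
by apply/negbTE; move: bad_j; rewrite {1}/mate (negPf j_even).
Qed.

End SymplecticForm.

End Pfaffian.

(** * Orbits of the special linear group on skew-symmetric matrices *)

Section SkewCongruence.

Variable K : fieldType.
Hypothesis charK0 : [pchar K] =i pred0.

Lemma skew_entry n (X : 'M[K]_n) i j : X^T = - X -> X i j = - X j i.
Proof. by move/matrixP/(_ j i); rewrite !mxE. Qed.

Lemma skew_entry_diag n (X : 'M[K]_n) i : X^T = - X -> X i i = 0.
Proof.
move=> skX; pose B : skew_mat K n := Sub X (introT eqP skX).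
exact: (skew_diag charK0 B).
Qed.

Lemma congr_skewP n m (A : 'M[K]_(m, n)) X :
  X^T = - X -> (A *m X *m A^T)^T = - (A *m X *m A^T).
Proof. by move=> skX; rewrite !trmx_mul trmxK skX mulmxA mulmxN mulNmx. Qed.

Lemma mxrank_congr n (A X : 'M[K]_n) :
  A \in unitmx -> \rank (A *m X *m A^T) = \rank X.
Proof.
move=> uA; rewrite mxrankMfree; last by rewrite row_free_unit unitmx_tr.
by rewrite -mxrank_tr trmx_mul mxrankMfree ?mxrank_tr // row_free_unit unitmx_tr.
Qed.

Definition sympl2 : 'M[K]_2 := delta_mx 0 1 - delta_mx 1 0.

Lemma sympl2_tr : sympl2^T = - sympl2.
Proof. by rewrite /sympl2 linearB /= !trmx_delta opprB. Qed.

Lemma mx2_1 : 1%:M = delta_mx 0 0 + delta_mx 1 1 :> 'M[K]_2.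
Proof.
rewrite mx1_sum_delta !big_ord_recl big_ord0 addr0.
by congr (_ + delta_mx _ _); apply/val_inj.
Qed.

Lemma sympl2_sqr : sympl2 *m sympl2 = - 1%:M.
Proof.
rewrite /sympl2 mulmxBl !mulmxBr !mul_delta_mx_cond /= !mulr0n !mulr1n mx2_1.
by rewrite sub0r subr0 opprD.
Qed.

(** A hyperbolic plane splits off from a nonzero alternating form: two basis
    vectors that are not orthogonal span one, and the form is nondegenerate
    there, so the plane has an orthogonal complement. *)
Lemma skew_split_plane n (X : 'M[K]_(2 + n)) : X^T = - X -> X != 0 ->
  exists2 A, A \in unitmx & exists2 c : 'M[K]_n, c^T = - c &
    A *m X *m A^T = block_mx sympl2 0 0 c.
Proof.
move=> skX X_neq0.
have /matrix0Pn[i0 [j0 Xij]] := X_neq0.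
have neq_ij : j0 != i0 by apply: contraNneq Xij => ->; rewrite skew_entry_diag.
(* A permutation of the basis that brings the indices [i0], [j0] to the front. *)
pose r0 : 'I_(2 + n) := lshift n 0; pose r1 : 'I_(2 + n) := lshift n 1.
pose t := tperm r0 i0; pose s := (tperm r1 (t j0) * t)%g.
have s0 : s r0 = i0.
  rewrite permM tpermD ?tpermL //; apply: contra neq_ij => /eqP e.
  by rewrite -(inj_eq (@perm_inj _ t)) e tpermR.
have s1 : s r1 = j0 by rewrite permM tpermL tpermK.
pose P : 'M[K]_(2 + n) := perm_mx s.
have [X1 defX1] : exists X1, X1 = P *m X *m P^T by exists (P *m X *m P^T).
have skX1 : X1^T = - X1 by rewrite defX1; apply: congr_skewP.
have X1E : X1 r0 r1 = X i0 j0.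
  by rewrite defX1 tr_perm_mx -row_permE -col_permE !mxE s0 s1.
pose x := X1 r0 r1; have x_neq0 : x != 0 by rewrite /x X1E.
pose b := ursubmx X1.
have ulX1 : ulsubmx X1 = x *: sympl2.
  have e0 (lt0 : (0 < 2)%N) : lshift n (Ordinal lt0) = r0 by apply/val_inj.
  have e1 (lt1 : (1 < 2)%N) : lshift n (Ordinal lt1) = r1 by apply/val_inj.
  apply/matrixP=> -[[|[|//]] lti] [[|[|//]] ltj]; rewrite !mxE ?e0 ?e1 /=.
  - by rewrite skew_entry_diag // subrr mulr0.
  - by rewrite subr0 mulr1.
  - by rewrite skew_entry // sub0r mulrN1.
  - by rewrite skew_entry_diag // subrr mulr0.
have dlX1 : dlsubmx X1 = - b^T.
  apply/matrixP=> i j; rewrite !mxE; exact: skew_entry.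
pose D : 'M[K]_2 := x^-1 *: delta_mx 0 0 + delta_mx 1 1.
have D_tr : D^T = D by rewrite /D linearD linearZ /= !trmx_delta.
have uD : D \in unitmx.
  apply: (@proj1 _ _ (@mulmx1_unit _ _ _ (x *: delta_mx 0 0 + delta_mx 1 1) _)).
  rewrite /D mulmxDl !mulmxDr -!scalemxAl -!scalemxAr !mul_delta_mx_cond /=.
  by rewrite !mulr0n !mulr1n !scaler0 addr0 add0r scalerA mulVf // scale1r -mx2_1.
have DsD : D *m (x *: sympl2) *m D = sympl2.
  rewrite /D -scalemxAr /sympl2 mulmxDl !mulmxBr -!scalemxAl !mul_delta_mx_cond /=.
  rewrite !mulr0n !mulr1n !scaler0 subr0 sub0r.
  rewrite mulmxDr !mulmxDl -?scalemxAr -?scalemxAl !mulNmx !mul_delta_mx_cond /=.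
  rewrite !mulr0n !mulr1n oppr0 !scaler0 add0r addr0.
  rewrite scalerDr !scalerN !scalerA mulfV // !scale1r.
  by rewrite addrC.
pose L : 'M[K]_(2 + n) := block_mx D 0 (- x^-1 *: (b^T *m sympl2)) 1%:M.
have uL : L \in unitmx.
  by rewrite unitmxE det_lblock det1 mulr1 -unitmxE.
exists (L *m P); first by rewrite unitmx_mul uL unitmx_perm.
pose c := drsubmx X1 + x^-1 *: (- b^T *m sympl2 *m b).
have LX1 : L *m X1 *m L^T = block_mx sympl2 0 0 c.
  rewrite -[X1]submxK ulX1 dlX1 -/b /L tr_block_mx !mulmx_block.
  rewrite D_tr !trmx0 !trmx1 !mul0mx !mulmx0 !mul1mx !mulmx1 !addr0.
  have -> : - x^-1 *: (b^T *m sympl2) *m (x *: sympl2) - b^T = 0.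
    rewrite -scalemxAl -scalemxAr scalerA mulNr mulVf // -mulmxA sympl2_sqr.
    by rewrite mulmxN mulmx1 scaleN1r opprK subrr.
  rewrite !mul0mx add0r DsD.
  have -> : D *m (x *: sympl2) *m (- x^-1 *: (b^T *m sympl2))^T + D *m b = 0.
    rewrite [(_ *: _)^T]linearZ /= trmx_mul trmxK sympl2_tr mulNmx scalerN scaleNr opprK.
    rewrite -mulmxA -scalemxAl -!scalemxAr scalerA mulfV // scale1r (mulmxA sympl2).
    by rewrite sympl2_sqr mulNmx mul1mx mulmxN addNr.
  by congr block_mx; rewrite addrC -scalemxAl scaleNr /c !mulNmx scalerN.
exists c; last by rewrite trmx_mul !mulmxA -LX1 defX1 !mulmxA.
have := congr_skewP L skX1; rewrite LX1 tr_block_mx opp_block_mx.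
by case/eq_block_mx.
Qed.

Lemma skew_congr_extend n (X X' : 'M[K]_(2 + n)) :
  (forall c c' : 'M[K]_n, c^T = - c -> c'^T = - c' -> \rank c = \rank c' ->
    exists2 A, A \in unitmx & A *m c *m A^T = c') ->
  X^T = - X -> X'^T = - X' -> \rank X = \rank X' -> X != 0 -> X' != 0 ->
  exists2 A, A \in unitmx & A *m X *m A^T = X'.
Proof.
move=> IHn skX skX' eq_rk X_neq0 X'_neq0.
have [A uA [c skc AX]] := skew_split_plane skX X_neq0.
have [A' uA' [c' skc' AX']] := skew_split_plane skX' X'_neq0.
have eq_rkc : \rank c = \rank c'.
  have := mxrank_congr X uA; rewrite AX rank_diag_block_mx eq_rk.
  by rewrite -(mxrank_congr X' uA') AX' rank_diag_block_mx => /addnI.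
have [C uC Cc] := IHn c c' skc skc' eq_rkc.
pose B : 'M[K]_(2 + n) := block_mx 1%:M 0 0 C.
have uB : B \in unitmx by rewrite unitmxE det_ublock det1 mul1r -unitmxE.
exists (invmx A' *m B *m A); first by rewrite !unitmx_mul unitmx_inv uA' uB.
have -> : invmx A' *m B *m A *m X *m (invmx A' *m B *m A)^T =
    invmx A' *m (B *m (A *m X *m A^T) *m B^T) *m (invmx A')^T.
  by rewrite !trmx_mul !mulmxA.
rewrite AX /B tr_block_mx !mulmx_block !trmx0 trmx1.
rewrite !mulmx0 ?mul0mx !mul1mx !mulmx1 ?mul0mx ?mulmx0 !addr0 ?add0r ?mul0mx Cc -AX'.
rewrite !mulmxA mulVmx // mul1mx -!mulmxA -trmx_mul mulVmx //.
by rewrite trmx1 mulmx1.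
Qed.

Lemma skew_congr_rank n (X X' : 'M[K]_n) :
  X^T = - X -> X'^T = - X' -> \rank X = \rank X' ->
  exists2 A, A \in unitmx & A *m X *m A^T = X'.
Proof.
have [m] := ubnP n; elim: m n X X' => // m IHm n X X'; rewrite ltnS => le_nm.
move=> skX skX' eq_rk.
have [X0|X_neq0] := eqVneq X 0.
  exists 1%:M; first exact: unitmx1.
  move: eq_rk; rewrite X0 mxrank0 mul1mx mul0mx => /esym/eqP.
  by rewrite mxrank_eq0 => /eqP.
have X'_neq0 : X' != 0 by rewrite -mxrank_eq0 -eq_rk mxrank_eq0.
case: n X X' le_nm skX skX' eq_rk X_neq0 X'_neq0 => [|[|n]] X X' le_nm skX skX' eq_rk.
- by rewrite [X]flatmx0 eqxx.
- by rewrite [X]mx11_scalar skew_entry_diag // raddf0 eqxx.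
move=> X_neq0 X'_neq0; apply: skew_congr_extend => // c c'.
exact/IHm/ltnW.
Qed.

(** Rescaling along a vector of the radical does not change the form, while the
    determinant of the rescaling is arbitrary. *)
Lemma skew_singular_isometry n (X : 'M[K]_n) d :
  X^T = - X -> (\rank X < n)%N -> d != 0 ->
  exists B, B *m X *m B^T = X /\ \det B = d.
Proof.
move=> skX rkX d_neq0.
have [v v_neq0 vX] : exists2 v : 'rV[K]_n, v != 0 & v *m X = 0.
  have: kermx X != 0 by rewrite -mxrank_eq0 mxrank_ker -lt0n subn_gt0.
  by case/rowV0Pn=> v /sub_kermxP vX v0; exists v.
have /rV0Pn[j vj] := v_neq0.
have [w wX wj] : exists2 w : 'rV[K]_n, w *m X = 0 & w 0 j = d - 1.
  exists (((d - 1) / v 0 j) *: v); first by rewrite -scalemxAl vX scaler0.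
  by rewrite mxE divfK.
have BX : (1%:M + delta_mx j 0 *m w) *m X = X.
  by rewrite mulmxDl mul1mx -mulmxA wX mulmx0 addr0.
exists (1%:M + delta_mx j 0 *m w); split.
  rewrite BX -[LHS]opprK -mulNmx -skX -trmx_mul BX skX.
  by rewrite opprK.
(* Factor the rescaling as a diagonal matrix times a unipotent one. *)
pose w' := d^-1 *: (w - (d - 1) *: delta_mx 0 j).
have w'j : w' 0 j = 0 by rewrite [w' 0 j]mxE [(w - _) 0 j]mxE wj !mxE !eqxx mulr1 subrr mulr0.
have -> : 1%:M + delta_mx j 0 *m w =
    Hmx j j (d - 1) *m (1%:M + delta_mx j 0 *m w').
  rewrite /Hmx mulmxDl !mulmxDr !mul1mx !mulmx1 -!scalemxAl mulmxA mul_delta_mx.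
  rewrite -addrA; congr (_ + _).
  have e1 : delta_mx j 0 *m w' + (d - 1) *: (delta_mx j 0 *m w') =
      d *: (delta_mx j 0 *m w').
    by rewrite -{1}[delta_mx j 0 *m w']scale1r -scalerDl addrC subrK.
  rewrite addrCA e1.
  rewrite /w' -scalemxAr scalerA divff // scale1r mulmxBr -scalemxAr mul_delta_mx.
  by rewrite addrC subrK.
by rewrite det_mulmx det_Hmx eqxx mulr1 (det_elemprod (elemprod_row w'j)) mulr1 addrC subrK.
Qed.

(** A congruence multiplies [Pf] by its determinant, so the value at the standard
    symplectic form decides. *)
Lemma Pf_nondegenerate n (X : 'M[K]_n) :
  ~~ odd n -> X^T = - X -> \rank X = n -> Pf X != 0.
Proof.
move=> n_even skX rkX; case: n n_even X skX rkX => [|n] n_even X skX rkX.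
  have -> : X = sympl_mx K 0 by rewrite [X]flatmx0 [RHS]flatmx0.
  exact: Pf_sympl_neq0.
have m_odd := odd_mate n_even; have mK := mateK n_even.
pose J := sympl_mx K n.+1.
have skJ : J^T = - J.
  apply/matrixP=> i j; rewrite !mxE -(inj_eq (inv_inj mK)) mK eq_sym.
  case: eqP => [->|_]; last by rewrite oppr0.
  by rewrite m_odd; case: (odd i); rewrite ?expr1 ?expr0 ?opprK.
have rkJ : \rank J = n.+1.
  apply: mxrank_unit; apply: (@proj1 _ _ (@mulmx1_unit _ _ _ (- J) _)).
  apply/matrixP=> i j; rewrite !mxE (bigD1 (mate i)) //= big1 => [|k ne_k].
    rewrite !mxE eqxx mK addr0 m_odd (eq_sym j); case: eqP => _.
      by case: (odd i); rewrite ?expr0 ?expr1 ?mulN1r ?mul1r ?opprK.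
    by rewrite oppr0 mulr0.
  by rewrite !mxE (negPf ne_k) mul0r.
have [A uA AX] := skew_congr_rank skX skJ (etrans rkX (esym rkJ)).
have [E eE defA] := unitmx_elemprod uA.
apply: contraNneq (Pf_sympl_neq0 charK0 n_even) => PfX0.
rewrite -/J -AX defA trmx_mul !mulmxA -(mulmxA E) -(mulmxA E).
by rewrite Pf_elemprod // Pf_Hmx // PfX0 mulr0.
Qed.

(** A congruence [A] is corrected to determinant [1]: in the singular case by an
    isometry of determinant [1 / det A]; in the invertible case [det A] is the
    ratio of the Pfaffians, hence already [1]. *)
Lemma skew_elemprod_congr n (X X' : 'M[K]_n) :
  X^T = - X -> X'^T = - X' -> \rank X = \rank X' -> Pf X = Pf X' ->
  exists2 E, elemprod E & E *m X *m E^T = X'.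
Proof.
case: n X X' => [|n] X X' skX skX' eq_rk eq_Pf.
  by exists 1%:M; [constructor | rewrite flatmx0 [RHS]flatmx0].
have [A uA AX] := skew_congr_rank skX skX' eq_rk.
have uD : \det A != 0 by rewrite -unitfE -unitmxE.
have [rk_lt|rk_ge] := ltnP (\rank X) n.+1.
  have [|B [BX detB]] := skew_singular_isometry skX rk_lt (d := (\det A)^-1).
    by rewrite invr_eq0.
  have detAB : \det (A *m B) = 1 by rewrite det_mulmx detB divff.
  have [|E eE defE] := @unitmx_elemprod K _ (A *m B).
    by rewrite unitmxE detAB unitr1.
  exists E => //; have -> : E = A *m B.
    by rewrite defE detAB subrr Hmx0 mulmx1.
  by rewrite trmx_mul !mulmxA -(mulmxA A) -(mulmxA A) BX.
have rkX : \rank X = n.+1 by apply/eqP; rewrite eqn_leq rank_leq_row.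
have n_even : ~~ odd n.+1.
  apply: contraTN isT => n_odd.
  have: \det X != 0 by rewrite -unitfE -unitmxE -row_free_unit /row_free rkX.
  have: \det X = - \det X.
    by rewrite -{1}det_tr skX -scaleN1r detZ -signr_odd n_odd expr1 mulN1r.
  move/eqP; rewrite -addr_eq0 -mulr2n -mulr_natl mulf_eq0.
  by rewrite (negPf (natf_neq0_char0 charK0 1)) /= => ->.
have [E eE defA] := unitmx_elemprod uA.
have PfX := Pf_nondegenerate n_even skX rkX.
have: Pf X' = \det A * Pf X.
  rewrite -AX {1 2}defA trmx_mul !mulmxA -(mulmxA E) -(mulmxA E).
  by rewrite Pf_elemprod // Pf_Hmx // eqxx mulr1 addrC subrK.
rewrite -eq_Pf -{1}[Pf X]mul1r => /(mulIf PfX) detA.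
by exists E => //; rewrite -AX defA -detA subrr Hmx0 mulmx1.
Qed.

End SkewCongruence.

(** * Moving one point while fixing finitely many others *)

Section OnePoint.

Variables (K : closedFieldType) (n : nat).
Hypothesis charK0 : [pchar K] =i pred0.
Implicit Types (X Y M : skew_mat K n) (F : seq (skew_mat K n)).
Implicit Types (g h : autY K n) (A P R : 'M[K]_n).

(** Elements of [G_skew] need not be linear, but they move each point inside its
    [SL_n]-orbit. This is kept along with the group element, because the points
    that are still to be moved must not change their rank and Pfaffian. *)
Definition Gorbital g : Prop :=
  Gskew g /\ forall B, exists2 A, elemprod A & g B = congr_act A B.

Definition connects F X Y : Prop :=
  exists g, [/\ Gorbital g, g X = Y & forall M, M \in F -> g M = M].

Lemma Gorbital1 : Gorbital (autY1 K n).
Proof.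
split=> [|B]; first exact: Gskew1.
by exists 1%:M; [constructor | rewrite congr_act1].
Qed.

Lemma GorbitalM g h : Gorbital g -> Gorbital h -> Gorbital (autYM g h).
Proof.
move=> [Gg og] [Gh oh]; split=> [|B]; first exact: GskewM.
have [A eA hB] := oh B; have [C eC gB] := og (h B).
exists (C *m A); first exact: elemprodM.
by rewrite congr_actM -hB -gB.
Qed.

Lemma GorbitalV g : Gorbital g -> Gorbital (autYV g).
Proof.
move=> [Gg og]; split=> [|B]; first exact: GskewV.
have [A eA gB] := og (autYV g B); have [C eC CA] := elemprodV eA.
by exists C; rewrite // -{2}(aut_invK g B) [g _]gB -congr_actM CA congr_act1.
Qed.

Lemma connects_refl F X : connects F X X.
Proof. by exists (autY1 K n); split=> //; apply: Gorbital1. Qed.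

Lemma connects_trans F X Y Z : connects F X Y -> connects F Y Z -> connects F X Z.
Proof.
move=> [g [Gg gX gF]] [h [Gh hY hF]]; exists (autYM h g); split.
- exact: GorbitalM.
- by rewrite /= gX.
- by move=> M FM; rewrite /= gF // hF.
Qed.

Lemma connects_sym F X Y : connects F X Y -> connects F Y X.
Proof.
move=> [g [Gg gX gF]]; exists (autYV g); split; first exact: GorbitalV.
- by rewrite -gX /= aut_funK.
- by move=> M FM; rewrite /= -{1}(gF M FM) aut_funK.
Qed.

Lemma Gorbital_elemprod A : elemprod A ->
  exists2 g, Gorbital g & forall B, g B = congr_act A B.
Proof.
elim=> [|p q t C neq_pq eC [g Gg gE]].
  by exists (autY1 K n) => [|B]; [apply: Gorbital1 | rewrite congr_act1].
have [h [Gh hE]] := Gskew_Hmx charK0 neq_pq t.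
exists (autYM h g) => [|B]; last by rewrite /= gE hE congr_actM.
apply: GorbitalM => //; split=> // B.
by exists (Hmx p q t); [apply: elemprodH | rewrite hE].
Qed.

Lemma connects_congr F X Y A : elemprod A ->
  connects (map (congr_act A) F) (congr_act A X) (congr_act A Y) ->
  connects F X Y.
Proof.
move=> eA [h [Gh hX hF]]; have [g Gg gE] := Gorbital_elemprod eA.
exists (autYM (autYV g) (autYM h g)); split.
- by apply: GorbitalM; [apply: GorbitalV | apply: GorbitalM].
- by rewrite /= gE hX -gE aut_funK.
- by move=> M FM; rewrite /= gE hF ?map_f // -gE aut_funK.
Qed.

Lemma congr_actK A R : R *m A = 1%:M -> cancel (@congr_act K n A) (congr_act R).
Proof. by move=> RA B; rewrite -congr_actM RA congr_act1. Qed.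

(** The conjugate [R (I + c E_pq) P] is a transvection along the linear form
    [row q P], and the vector [row q P *m X] plays for it the role that row [q]
    of [X] plays for [H_pq]. *)
Lemma connects_sep F X P R p q c : elemprod P -> R *m P = 1%:M -> p != q ->
  (forall M, M \in F -> row q P *m (val X - val M) != 0) ->
  connects F X (congr_act (R *m Hmx p q c *m P) X).
Proof.
move=> eP RP neq_pq sepF; apply: (connects_congr eP).
rewrite -congr_actM !mulmxA (mulmx1C RP) mul1mx congr_actM.
have [|g [Gg og gX gF]] := @Gskew_replica_sep _ _ _ _ charK0 neq_pq
    (map (congr_act P) F) (congr_act P X) c.
  move=> _ /mapP[M FM ->]; apply/existsP; apply: contraR (sepF M FM).
  rewrite negb_exists => /forallP eqMX.
  have uPT : P^T \in unitmx by rewrite unitmx_tr; apply: elemprod_unitmx.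
  apply/eqP; apply: (can_inj (mulmxK uPT)); rewrite mul0mx.
  apply/rowP=> k; have := eqMX k; rewrite negbK => /eqP.
  rewrite /= -!row_mul mulmxBr mulmxBl !mxE => ->.
  by rewrite subrr.
exists g; split=> //; split=> // B; have [t ->] := og B.
by exists (Hmx p q t) => //; apply: elemprodH.
Qed.

(** Finitely many proper subspaces do not cover the affine hyperplane [a_q = 1]:
    the curve with coordinates [t^0] at [q] and distinct positive powers of [t]
    elsewhere meets each of them in finitely many points. *)
Lemma generic_row m (q : 'I_n) (Ds : seq 'M[K]_(n, m)) : 0 \notin Ds ->
  exists2 a : 'rV[K]_n, a 0 q = 1 & forall D, D \in Ds -> a *m D != 0.
Proof.
pose e (l : 'I_n) : nat := if l == q then 0%N else l.+1.
have inj_e : injective e.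
  move=> l1 l2; rewrite /e; case: eqP => [->|_]; case: eqP => [->|_] //.
  by case=> /val_inj.
pose a t : 'rV[K]_n := \row_l t ^+ e l.
have polyD (D : 'M[K]_(n, m)) : D != 0 ->
    exists2 Q : {poly K}, Q != 0 & forall t, a t *m D = 0 -> root Q t.
  move=> /matrix0Pn[i [j Dij]].
  exists (\sum_l D l j *: 'X^(e l)).
    apply: contraNneq Dij => /(congr1 (coefp (e i))); rewrite /= coef0 => <-.
    rewrite coef_sum (bigD1 i) //= coefZ coefXn eqxx mulr1 big1 ?addr0 // => l ne_li.
    by rewrite coefZ coefXn (inj_eq inj_e) eq_sym (negPf ne_li) mulr0.
  move=> t /matrixP/(_ 0 j); rewrite !mxE => aDj; apply/rootP.
  rewrite -[RHS]aDj horner_sum; apply: eq_bigr => l _.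
  by rewrite hornerZ hornerXn mxE mulrC.
move=> Ds0; suff [Q Q_neq0 QP] : exists2 Q : {poly K}, Q != 0 &
    forall t D, D \in Ds -> a t *m D = 0 -> root Q t.
  have /closed_nonrootP[t nQt] := Q_neq0.
  exists (a t) => [|D DsD]; first by rewrite mxE /e eqxx.
  by apply: contraNneq nQt; apply: QP.
elim: Ds Ds0 => [|D Ds IH]; first by exists 1; rewrite ?oner_eq0.
rewrite inE negb_or eq_sym => /andP[/polyD[Q Q0 QP] /IH[Q' Q'0 Q'P]].
exists (Q * Q'); first by rewrite mulf_neq0.
move=> t E; rewrite inE rootM => /orP[/eqP->|DsE] aE; first by rewrite QP.
by rewrite (Q'P t E) // orbT.
Qed.

Lemma skew_neq_entry X Y p : X != Y ->
  exists i j, i != p /\ val X i j != val Y i j.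
Proof.
move=> neq_XY; have [i [j neq_ij]] : exists i j, val X i j != val Y i j.
  have: val X - val Y != 0 by rewrite subr_eq0 (inj_eq val_inj).
  by case/matrix0Pn=> i [j]; rewrite !mxE subr_eq0; exists i, j.
have [eq_ip|neq_ip] := eqVneq i p; last by exists i, j.
exists j, i; split; last by rewrite skewE (skewE Y) eqr_opp.
by rewrite -eq_ip; apply: contraNneq neq_ij => ->; rewrite !skew_diag.
Qed.

(** The factors of [I + c E_pq = (I + c/2 e_p (e_q - w)) (I + c/2 e_p (e_q + w))]
    are transvections, and for generic [w] neither of the linear forms
    [e_q + w], [e_q - w] is special for the given points. *)
Lemma connects_Hmx F X p q c : p != q ->
  X \notin F -> congr_act (Hmx p q c) X \notin F ->
  connects F X (congr_act (Hmx p q c) X).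
Proof.
move=> neq_pq; set X' := congr_act _ X => FX FX'.
(* For a row [a] with [a_q = 1], [a Z] is [e_q + w] with [w_p = w_q = 0], and
   [a U Z] is [e_q - w]. *)
pose Z : 'M[K]_n := 1%:M - delta_mx p p.
pose U : 'M[K]_n := 2%:R *: delta_mx q q - 1%:M.
have UU : U *m U = 1%:M.
  rewrite /U mulmxBl !mulmxBr !mul1mx !mulmx1 -scalemxAl -scalemxAr.
  rewrite mul_delta_mx scalerA (_ : 2%:R * 2%:R = 2%:R + 2%:R); last by ring.
  by rewrite scalerDl addrK opprB addrCA subrr addr0.
have Z0 B M : B != M -> Z *m (val B - val M) != 0.
  move=> /(@skew_neq_entry _ _ p)[i [j [neq_ip neqBM]]].
  apply: contraNneq neqBM => /matrixP/(_ i j)/eqP.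
  rewrite mulmxBl mul1mx !mxE (bigD1 p) //= !mxE (negPf neq_ip) mul0r add0r.
  by rewrite big1 ?subr0 ?subr_eq0 // => l _; rewrite mxE (negPf neq_ip) mul0r.
pose Ds := [seq Z *m (val X - val M) | M <- F]
        ++ [seq U *m (Z *m (val X' - val M)) | M <- F].
have [|a aq aDs] := @generic_row n q Ds.
  rewrite mem_cat; apply/norP; split; apply/mapP=> -[M FM].
    by apply/eqP; rewrite eq_sym Z0 //; apply: contraNneq FX => ->.
  move/(congr1 (mulmx U))/esym/eqP; rewrite mulmxA UU mul1mx mulmx0.
  by rewrite (negPf (Z0 _ _ _)) //; apply: contraNneq FX' => ->.
have [w defw] : exists w, w = a *m Z - delta_mx 0 q by exists (a *m Z - delta_mx 0 q).
have wp0 : w *m (delta_mx p 0 : 'cV_n) = 0.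
  rewrite defw /Z mulmxBl -mulmxA mulmxBl mul1mx mul_delta_mx subrr mulmx0.
  by rewrite mul_delta_mx_0 ?subr0 // eq_sym.
have wq0 : w *m (delta_mx q 0 : 'cV_n) = 0.
  rewrite defw /Z mulmxBl -mulmxA mulmxBl mul1mx mul_delta_mx_0 // subr0.
  by rewrite mul_delta_mx -colE; apply/matrixP=> i j; rewrite !ord1 !mxE aq subrr.
have wE (r : 'I_n) : w *m (delta_mx r 0 : 'cV_n) = 0 -> w 0 r = 0.
  by rewrite -colE => /matrixP/(_ 0 0); rewrite !mxE.
pose S : 'M[K]_n := 1%:M + delta_mx q 0 *m w.
pose Sv : 'M[K]_n := 1%:M - delta_mx q 0 *m w.
have eS : elemprod S by apply/elemprod_row/wE.
have eSv : elemprod Sv.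
  rewrite /Sv -mulmxN; apply: elemprod_row.
  by rewrite mxE wE // oppr0.
have qwqw : delta_mx q 0 *m w *m (delta_mx q 0 *m w) = 0.
  by rewrite -mulmxA (mulmxA w) wq0 mul0mx mulmx0.
have SvS : Sv *m S = 1%:M.
  by rewrite /Sv /S mulmxBl !mulmxDr !mul1mx !mulmx1 qwqw addr0 addrK.
have row_qq : row q (delta_mx q 0) = 1%:M :> 'M[K]_1.
  by apply/matrixP=> i j; rewrite !ord1 !mxE !eqxx.
have rowS : row q S = a *m Z.
  rewrite /S linearD /= row1 row_mul row_qq.
  by rewrite mul1mx defw addrC subrK.
have rowSv : row q Sv = a *m U *m Z.
  rewrite /Sv linearB /= row1 row_mul row_qq.
  have aqq : a *m delta_mx q q = delta_mx 0 q.
    apply/rowP=> j; rewrite !mxE (bigD1 q) //= !mxE aq eqxx mul1r big1 ?addr0 // => l nl.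
    by rewrite !mxE (negPf nl) mulr0.
  have qZ : (delta_mx 0 q : 'rV_n) *m Z = delta_mx 0 q.
    by rewrite /Z mulmxBr mulmx1 mul_delta_mx_0 ?subr0 // eq_sym.
  have aU : a *m U = 2%:R *: delta_mx 0 q - a.
    by rewrite /U mulmxBr -scalemxAr aqq mulmx1.
  rewrite mul1mx defw aU mulmxBl -scalemxAl qZ.
  by rewrite opprB addrA scaler_nat mulr2n.
pose T t := Sv *m Hmx p q t *m S; pose T' t := S *m Hmx p q t *m Sv.
have d11 : delta_mx 0 0 = 1%:M :> 'M[K]_1.
  by apply/matrixP=> i j; rewrite !ord1 !mxE !eqxx.
have pq_split : delta_mx p q =
    (delta_mx p 0 : 'cV_n) *m (delta_mx 0 q : 'rV_n) :> 'M[K]_n.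
  by rewrite mul_delta_mx.
have Sp : S *m (delta_mx p 0 : 'cV_n) = delta_mx p 0.
  by rewrite /S mulmxDl mul1mx -mulmxA wp0 mulmx0 addr0.
have Svp : Sv *m (delta_mx p 0 : 'cV_n) = delta_mx p 0.
  by rewrite /Sv mulmxBl mul1mx -mulmxA wp0 mulmx0 subr0.
have qS : (delta_mx 0 q : 'rV_n) *m S = delta_mx 0 q + w.
  by rewrite /S mulmxDr mulmx1 mulmxA mul_delta_mx d11 mul1mx.
have qSv : (delta_mx 0 q : 'rV_n) *m Sv = delta_mx 0 q - w.
  by rewrite /Sv mulmxBr mulmx1 mulmxA mul_delta_mx d11 mul1mx.
have SSv : S *m Sv = 1%:M by apply: mulmx1C.
clearbody S Sv.
have TE t : T t = 1%:M + t *: ((delta_mx p 0 : 'cV_n) *m (delta_mx 0 q + w)).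
  rewrite /T /Hmx (mulmxDr Sv) mulmx1 mulmxDl SvS -scalemxAr -scalemxAl pq_split.
  by rewrite mulmxA Svp -mulmxA qS.
have T'E t : T' t = 1%:M + t *: ((delta_mx p 0 : 'cV_n) *m (delta_mx 0 q - w)).
  rewrite /T' /Hmx (mulmxDr S) mulmx1 mulmxDl SSv -scalemxAr -scalemxAl pq_split.
  by rewrite mulmxA Sp -mulmxA qSv.
have T'T : T' (c / 2%:R) *m T (c / 2%:R) = Hmx p q c.
  have qp0 : (delta_mx 0 q : 'rV[K]_n) *m (delta_mx p 0 : 'cV[K]_n) = 0.
    by rewrite mul_delta_mx_0 // eq_sym.
  have mulT (u1 u2 : 'rV[K]_n) (e : 'cV[K]_n) t : u1 *m e = 0 ->
      (1%:M + t *: (e *m u1)) *m (1%:M + t *: (e *m u2)) =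
      1%:M + t *: (e *m (u1 + u2)).
    move=> u1e; rewrite mulmxDl mul1mx (mulmxDr (t *: _)) mulmx1 -scalemxAl.
    rewrite -scalemxAr -mulmxA (mulmxA u1) u1e mul0mx mulmx0 !scaler0 addr0.
    by rewrite mulmxDr scalerDr -addrA [X in _ + X]addrC.
  rewrite TE T'E mulT; last by rewrite mulmxBl qp0 wp0 subrr.
  rewrite addrACA addNr addr0 mulmxDr -pq_split -mulr2n -scaler_nat scalerA.
  by rewrite divfK ?natf_neq0_char0.
have T'V t : T' (- t) *m T' t = 1%:M.
  rewrite /T' !mulmxA -(mulmxA _ Sv S) SvS mulmx1 -(mulmxA S) HmxVK //.
  by rewrite mulmx1.
apply: (@connects_trans _ _ (congr_act (T (c / 2%:R)) X)).
  apply: connects_sep => // M FM; rewrite rowS -mulmxA.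
  by apply: aDs; rewrite mem_cat (map_f (fun M => Z *m (val X - val M))).
(* The second factor is undone from [X'], where its linear form separates. *)
apply: connects_sym.
have -> : congr_act (T (c / 2%:R)) X = congr_act (T' (- (c / 2%:R))) X'.
  by rewrite /X' -T'T -!congr_actM mulmxA T'V mul1mx.
apply: connects_sep => // M FM; rewrite rowSv -!mulmxA; apply: aDs.
by rewrite mem_cat (map_f (fun M => U *m (Z *m (val X' - val M)))) ?orbT.
Qed.

Lemma connects_transv F X P R p q c : elemprod P -> R *m P = 1%:M -> p != q ->
  X \notin F -> congr_act (R *m Hmx p q c *m P) X \notin F ->
  connects F X (congr_act (R *m Hmx p q c *m P) X).
Proof.
move=> eP RP neq_pq FX FX'; apply: (connects_congr eP).
have injP := can_inj (congr_actK RP).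
have congrE : congr_act P (congr_act (R *m Hmx p q c *m P) X) =
    congr_act (Hmx p q c) (congr_act P X).
  by rewrite -!congr_actM !mulmxA (mulmx1C RP) mul1mx.
rewrite congrE; apply: connects_Hmx; rewrite -?congrE ?mem_map //.
Qed.

Lemma congr_elemprod_neq0 A X :
  elemprod A -> val X != 0 -> val (congr_act A X) != 0.
Proof.
move=> eA; rewrite -!mxrank_eq0 /= mxrank_congr //; exact: elemprod_unitmx.
Qed.

(** A chain of elementary moves from [X] to [A X], translated by [P], is a chain
    of transvections from [P X] to [P A X]; it can be followed in steps as soon
    as the translated points avoid [F]. *)
Lemma connects_chain X A : elemprod A -> val X != 0 ->
  exists2 Ys : seq (skew_mat K n), (forall Y, Y \in Ys -> val Y != 0) &
  forall F P, elemprod P -> (forall Y, Y \in Ys -> congr_act P Y \notin F) ->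
    connects F (congr_act P X) (congr_act P (congr_act A X)).
Proof.
move=> eA X_neq0; elim: eA => [|p q c B neq_pq eB [Ys Ys0 YsP]].
  by exists [::] => // F P _ _; rewrite congr_act1; apply: connects_refl.
have eHB : elemprod (Hmx p q c *m B) by constructor.
exists [:: congr_act B X, congr_act (Hmx p q c *m B) X & Ys].
  move=> Y; rewrite !inE => /or3P[/eqP->|/eqP->|]; last exact: Ys0.
    exact: congr_elemprod_neq0.
  exact: congr_elemprod_neq0.
move=> F P eP avoidF; apply: connects_trans (YsP F P eP _) _.
  by move=> Y YsY; apply: avoidF; rewrite !inE YsY !orbT.
have [R eR RP] := elemprodV eP.
have moveE : congr_act P (congr_act (Hmx p q c *m B) X) =
    congr_act (P *m Hmx p q c *m R) (congr_act P (congr_act B X)).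
  by rewrite -!congr_actM -!mulmxA (mulmxA R) RP mul1mx.
have avoid0 := avoidF (congr_act B X); have avoid1 := avoidF (congr_act (Hmx p q c *m B) X).
rewrite moveE in avoid1 *; apply: connects_transv => //; first exact: mulmx1C.
  by apply: avoid0; rewrite inE eqxx.
by apply: avoid1; rewrite !inE eqxx orbT.
Qed.

Lemma generic_scalar (s : seq K) : exists c, c \notin s.
Proof.
have /closed_nonrootP[c] : \prod_(x <- s) ('X - x%:P) != 0.
  by rewrite monic_neq0 // monic_prod_XsubC.
by rewrite root_prod_XsubC; exists c.
Qed.

(** After a change of basis by [P] all [Y] have a nonzero entry [y_qk] with [k]
    different from [p] and [q]; then [y_pk + c y_qk] depends on [c], and only
    finitely many values of [c] take some [Y] into [F]. A third index exists only
    for [n > 2], and indeed [SL_2] acts trivially. *)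
Lemma generic_transv F (Ys : seq (skew_mat K n)) : (2 < n)%N ->
  (forall Y, Y \in Ys -> val Y != 0) ->
  exists P R p q c, [/\ elemprod P, R *m P = 1%:M, p != q &
    forall Y, Y \in Ys -> congr_act (R *m Hmx p q c *m P) Y \notin F].
Proof.
move=> n_gt2 Ys0.
pose p := Ordinal n_gt2; pose q := Ordinal (ltnW n_gt2).
pose k := Ordinal (ltnW (ltnW n_gt2)).
have neq_pq : p != q by []; have neq_kp : k != p by [].
have row_elem r (a : 'rV[K]_n) : a 0 r = 1 ->
    exists2 P, elemprod P & (row r P = a /\ forall i, i != r -> row i P = row i 1%:M).
  move=> ar; pose w := a - delta_mx 0 r.
  exists (1%:M + delta_mx r 0 *m w).
    by apply: elemprod_row; rewrite !mxE !eqxx ar subrr.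
  split=> [|i ne_ir].
    apply/rowP=> j; rewrite !mxE big_ord1 !mxE !eqxx mul1r eq_sym.
    by rewrite addrC subrK.
  by apply/rowP=> j; rewrite !mxE big_ord1 !mxE (negPf ne_ir) mul0r addr0.
have [|b bk bP] := @generic_row n k [seq val Y | Y <- Ys].
  by apply/mapP=> -[Y /Ys0 Y0 e]; rewrite -e eqxx in Y0.
have [B eB [rowB _]] := row_elem k b bk.
have colB Y : col k (val (congr_act B Y)) = B *m (val Y *m b^T).
  by rewrite /= colE -!mulmxA -colE -tr_row rowB.
have [|a aq aP] := @generic_row 1 q [seq col k (val (congr_act B Y)) | Y <- Ys].
  apply/mapP=> -[Y YsY]; rewrite colB => /(congr1 (mulmx (invmx B)))/esym/eqP.
  rewrite mulKmx ?elemprod_unitmx // mulmx0 -trmx_eq0 trmx_mul trmxK.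
  rewrite (eqP (valP Y)) mulmxN oppr_eq0; apply/negP/bP.
  by apply/mapP; exists Y.
have [A eA [rowA rowA1]] := row_elem q a aq.
pose P := A *m B; have eP : elemprod P by apply: elemprodM.
have [R eR RP] := elemprodV eP.
have Pqk Y : Y \in Ys -> val (congr_act P Y) q k != 0.
  move=> YsY; have := aP _ (map_f (fun Y => col k (val (congr_act B Y))) YsY).
  have -> : a *m col k (val (congr_act B Y)) = row q (col k (val (congr_act P Y))).
    rewrite /P congr_actM; move: (congr_act B Y) => Z /=.
    have colA (N : 'M[K]_n) : col k (N *m A^T) = col k N.
      rewrite colE -mulmxA -colE -tr_row rowA1 //.
      by rewrite rowE mulmx1 trmx_delta -colE.
    by rewrite colA !colE -mulmxA row_mul rowA.
  by apply: contraNneq => e0; apply/eqP/matrixP=> i j; rewrite !ord1 mxE mxE e0 mxE.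
pose bad_val M Y : K :=
  (val (congr_act P M) p k - val (congr_act P Y) p k) / val (congr_act P Y) q k.
have [c bad_c] := generic_scalar [seq bad_val M Y | M <- F, Y <- Ys].
exists P, R, p, q, c; split=> // Y YsY; apply: contra bad_c => FM.
suff -> : c = bad_val (congr_act (R *m Hmx p q c *m P) Y) Y by apply: allpairs_f.
have PE : congr_act P (congr_act (R *m Hmx p q c *m P) Y) =
    congr_act (Hmx p q c) (congr_act P Y).
  by rewrite -!congr_actM !mulmxA (mulmx1C RP) mul1mx.
rewrite /bad_val PE congr_actHE // eqxx (negPf neq_kp) mul1r mul0r addr0.
by rewrite addrC addKr mulfK // Pqk.
Qed.

Lemma congr_act_small A X : (n <= 2)%N -> elemprod A -> congr_act A X = X.
Proof.
move=> n_le2; elim=> [|p q t B neq_pq _ IH]; first exact: congr_act1.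
rewrite congr_actM IH; apply/val_inj/matrixP=> i j.
have other (l : 'I_n) : l != p -> l = q.
  move=> neq_lp; apply/eqP; apply: contraLR n_le2 => neq_lq; rewrite -ltnNge.
  have /card_uniqP : uniq [:: l; p; q] by rewrite /= !inE negb_or neq_lp neq_lq neq_pq.
  by move=> /= <-; rewrite -[X in (_ <= X)%N]card_ord max_card.
rewrite congr_actHE //.
have [->|/other ->] := eqVneq i p; have [->|/other ->] := eqVneq j p;
rewrite ?eqxx ?[q == p]eq_sym ?(negPf neq_pq) ?mul1r ?mul0r ?skew_diag ?addr0 ?add0r ?mulr0 ?addr0 //.
by rewrite addrC skewE addNr mulr0.
Qed.

Lemma connects_elemprod F X A : elemprod A ->
  X \notin F -> congr_act A X \notin F -> connects F X (congr_act A X).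
Proof.
move=> eA FX FAX; have [n_le2|n_gt2] := leqP n 2.
  by rewrite congr_act_small //; apply: connects_refl.
have [X0|X_neq0] := eqVneq (val X) 0.
  have -> : congr_act A X = X by apply/val_inj; rewrite /= X0 mulmx0 mul0mx.
  exact: connects_refl.
have [Ys Ys0 chain] := connects_chain eA X_neq0.
have [|P [R [p [q [c [eP RP neq_pq PF]]]]]] :=
    @generic_transv F [:: X, congr_act A X & Ys] n_gt2.
  move=> Y; rewrite !inE => /or3P[/eqP->|/eqP->|]; [by []| |exact: Ys0].
  exact: congr_elemprod_neq0.
set T := R *m _ *m P in PF.
have eT : elemprod T.
  apply: elemprodM => //; apply: elemprodM; last exact: elemprodH.
  have [R' eR' R'P] := elemprodV eP.
  by rewrite -[R]mulmx1 -(mulmx1C R'P) mulmxA RP mul1mx.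
have FT Y : Y \in [:: X, congr_act A X & Ys] -> Y \notin F ->
    connects F Y (congr_act T Y).
  by move=> YsY FY; apply: connects_transv => //; apply: PF.
apply: (@connects_trans _ _ (congr_act T X)).
  by apply: FT; rewrite // inE eqxx.
apply: (@connects_trans _ _ (congr_act T (congr_act A X))).
  by apply: chain => // Y YsY; apply: PF; rewrite !inE YsY !orbT.
by apply/connects_sym/FT; rewrite // !inE eqxx orbT.
Qed.

End OnePoint.

(** * Collective transitivity *)

Theorem theorem3p6 (K : closedFieldType) (charK0 : [pchar K] =i pred0)
    (n : nat) (hn : (2 <= n)%N) (k : nat) (M M' : 'I_k -> skew_mat K n)
    (injM : injective M) (injM' : injective M')
    (rkM : forall i, \rank (val (M i)) = \rank (val (M' i)))
    (PfM : forall i, Pf (val (M i)) = Pf (val (M' i))) :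
  exists g : autY K n, Gskew g /\ forall i, g (M i) = M' i.
Proof.
suff main m : (m <= k)%N -> exists2 g : autY K n, Gorbital g &
    forall i : 'I_k, (i < m)%N -> g (M i) = M' i.
  have [g [Gg _] gM] := main k (leqnn k).
  by exists g; split=> // i; apply: gM.
elim: m => [|m IHm] lt_mk; first by exists (autY1 K n) => //; apply: Gorbital1.
have [g Gg gM] := IHm (ltnW lt_mk).
pose i0 : 'I_k := Ordinal lt_mk; pose F := [seq M' i | i : 'I_k <- enum 'I_k & (i < m)%N].
have skB (B : skew_mat K n) : (val B)^T = - val B := eqP (valP B).
have [A eA gA] := Gg.2 (M i0).
have [E eE defE] := skew_elemprod_congr charK0 (skB _) (skB _) (rkM i0) (PfM i0).
have [C eC CA] := elemprodV eA.
have gE : congr_act (E *m C) (g (M i0)) = M' i0.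
  rewrite gA congr_actM (congr_actK CA); apply/val_inj; exact: defE.
have FgM : g (M i0) \notin F.
  apply/mapP=> -[i]; rewrite mem_filter => /andP[lt_im _].
  rewrite -gM // => /(can_inj (aut_funK g))/injM ii0.
  by rewrite -ii0 ltnn in lt_im.
have FM' : M' i0 \notin F.
  apply/mapP=> -[i]; rewrite mem_filter => /andP[lt_im _] /injM' ii0.
  by rewrite -ii0 ltnn in lt_im.
have [|||h [Gh hM hF]] := @connects_elemprod _ _ charK0 F (g (M i0)) (E *m C).
- exact: elemprodM.
- by [].
- by rewrite gE.
exists (autYM h g) => [|i]; first exact: GorbitalM.
rewrite ltnS leq_eqVlt => /orP[/eqP im|lt_im] /=.
  by have -> : i = i0; [apply/val_inj | rewrite hM gE].
rewrite gM // hF //; apply/mapP; exists i => //.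
by rewrite mem_filter lt_im mem_enum.
Qed.
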